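(* Let $M$ be an $m$-dimensional Riemannian manifold with Riemannian measure $\mu$, let $\Omega\subset M$ be an open, relatively compact, connected subset, and let $d(x)=\operatorname{dist}(x,\partial\Omega)$. Let $V\in C(\Omega)$, $V>0$ in $\Omega$. Assume that $$C_0[d(x)]^{-\beta_0}\le V(x)\le C_1[d(x)]^{-\beta_1}\quad\text{for all }x\in\Omega,$$ for some $C_1>C_0>0$ and $\beta_1\ge\beta_0>2$. Then $\bar\lambda(\Omega)=0$.
   Context: For $\delta>0$ let $\mathcal S^\delta=\{x\in\Omega:d(x)<\delta\}$ and $\Omega^\delta=\Omega\setminus\overline{\mathcal S^\delta}$. Let $\lambda_\delta$ be the first eigenvalue of the weighted Dirichlet problem $\Delta\phi+\lambda V\phi=0$ in $\Omega^\delta$, $\phi=0$ on $\partial\Omega^\delta$, where $\Delta$ is the Laplace-Beltrami operator, i.e. $$\lambda_\delta=\inf_{\phi\in C_c^\infty(\Omega^\delta),\,\phi\not\equiv0}\frac{\int_{\Omega^\delta}|\nabla\phi|^2\,d\mu}{\int_{\Omega^\delta}V\phi^2\,d\mu}.$$ Then $\lambda_\delta$ is monotone in $\delta$ and $\bar\lambda(\Omega):=\lim_{\delta\to0^+}\lambda_\delta\in[0,\infty)$; equivalently, $$\bar\lambda(\Omega)=\inf_{\phi\in C_c^\infty(\Omega),\,\phi\not\equiv0}\frac{\int_\Omega|\nabla\phi|^2\,d\mu}{\int_\Omega V\phi^2\,d\mu}.$$ *)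

(* Defs.v *)
From HB Require Import structures.
From mathcomp Require Import all_boot all_order all_algebra.
From mathcomp Require Import all_classical all_reals all_analysis.

Set Implicit Arguments.
Unset Strict Implicit.
Unset Printing Implicit Defensive.

Import Order.TTheory GRing.Theory Num.Theory.
Import numFieldNormedType.Exports.

Local Open Scope classical_set_scope.
Local Open Scope ring_scope.

(* For U open: C^0 is continuity on U, and C^(k+1) means differentiable on U
   with all first partial derivatives C^k on U. *)
Fixpoint Ck_on (R : realType) (m : nat) (W : normedModType R) (k : nat)
    (U : set 'rV[R]_m) (f : 'rV[R]_m -> W) : Prop :=
  match k with
  | 0 => forall x, U x -> {for x, continuous f}
  | k'.+1 => (forall x, U x -> differentiable f x) /\
             (forall i : 'I_m, Ck_on k' U ('D_(delta_mx 0 i) f))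
  end.

Definition smooth_on (R : realType) (m : nat) (W : normedModType R)
    (U : set 'rV[R]_m) (f : 'rV[R]_m -> W) : Prop :=
  forall k, Ck_on k U f.

(* coord and param are total functions, meaningful only on dom and on
   coord @` dom respectively. *)
Record chart (R : realType) (m : nat) (M : topologicalType) := Chart {
  dom : set M ;
  coord : M -> 'rV[R]_m ;
  param : 'rV[R]_m -> M ;
  dom_open : open dom ;
  range_open : open (coord @` dom) ;
  coordK : forall x, dom x -> param (coord x) = x ;
  coord_continuous : forall x, dom x -> {for x, continuous coord} ;
  param_continuous :
    forall y, (coord @` dom) y -> {for y, continuous param} }.

Definition chart_range (R : realType) (m : nat) (M : topologicalType)
  (c : chart R m M) : set 'rV[R]_m := coord c @` dom c.

(* Matrices act on row vectors, so in the chart c the inner product of the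
   tangent vectors with coordinates v, w is v *m metric c x *m w^T, and the
   Jacobian 'J F of a map F sends v to v *m 'J F. *)
Record riemannianManifold (R : realType) (m : nat) (M : topologicalType) :=
  RiemannianManifold {
  manifold_hausdorff : hausdorff_space M ;
  manifold_second_countable : @second_countable M ;
  atlas : set (chart R m M) ;
  chart_at : M -> chart R m M ;
  chart_at_atlas : forall x, atlas (chart_at x) ;
  chart_at_dom : forall x, dom (chart_at x) x ;
  atlas_compatible : forall c c', atlas c -> atlas c' ->
    smooth_on (coord c @` (dom c `&` dom c')) (coord c' \o param c) ;
  metric : chart R m M -> M -> 'M[R]_m ;
  metric_smooth : forall c, atlas c ->
    smooth_on (chart_range c) (metric c \o param c) ;
  metric_sym : forall c x, atlas c -> dom c x ->
    (metric c x)^T = metric c x ;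
  metric_posdef : forall c x (v : 'rV[R]_m), atlas c -> dom c x -> v != 0 ->
    0 < (v *m metric c x *m v^T) 0 0 ;
  metric_compatible : forall c c' x, atlas c -> atlas c' ->
    dom c x -> dom c' x ->
    let J := 'J (coord c' \o param c) (coord c x) in
    metric c x = J *m metric c' x *m J^T }.

(* C^1 curves [0, 1] -> M.  Differentiability is two-sided at the endpoints,
   i.e. the curve is the restriction of a C^1 curve on a larger interval, as
   every C^1 curve on a closed interval is. *)
Definition C1_curve (R : realType) (m : nat) (M : topologicalType)
    (X : riemannianManifold R m M) (gamma : R -> M) : Prop :=
  forall t : R, 0 <= t <= 1 ->
    {for t, continuous gamma} /\
    (forall c, atlas X c -> dom c (gamma t) ->
       (\forall s \near t, derivable (coord c \o gamma) s 1) /\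
       {for t, continuous (derive1 (coord c \o gamma))}).

(* chart_at selects a chart; by metric_compatible the value is the same in any
   other chart of the atlas (likewise for grad_sq). *)
Definition speed (R : realType) (m : nat) (M : topologicalType)
    (X : riemannianManifold R m M) (gamma : R -> M) (t : R) : R :=
  let c := chart_at X (gamma t) in
  let v : 'rV[R]_m := derive1 (coord c \o gamma) t in
  Num.sqrt ((v *m metric X c (gamma t) *m v^T) 0 0).

Definition curve_length (R : realType) (m : nat) (M : topologicalType)
    (X : riemannianManifold R m M) (gamma : R -> M) : \bar R :=
  (\int[lebesgue_measure]_(t in `[0%R, 1%R]) (speed X gamma t)%:E)%E.

(* piecewise_C1 X x y l: some concatenation of finitely many C^1 curves joins
   x to y and has total length l. *)
Inductive piecewise_C1 (R : realType) (m : nat) (M : topologicalType)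
    (X : riemannianManifold R m M) : M -> M -> \bar R -> Prop :=
| piecewise_C1_nil x : piecewise_C1 X x x 0%E
| piecewise_C1_cons gamma y l :
    C1_curve X gamma -> piecewise_C1 X (gamma 1) y l ->
    piecewise_C1 X (gamma 0) y (curve_length X gamma + l)%E.

Definition riem_dist (R : realType) (m : nat) (M : topologicalType)
    (X : riemannianManifold R m M) (x y : M) : \bar R :=
  ereal_inf [set l | piecewise_C1 X x y l].

Definition boundary (M : topologicalType) (A : set M) : set M :=
  closure A `\` A°.

Definition bdist (R : realType) (m : nat) (M : topologicalType)
    (X : riemannianManifold R m M) (Omega : set M) (x : M) : \bar R :=
  ereal_inf [set riem_dist X x y | y in boundary Omega].

(* The iterated integral over R^m, one coordinate at a time; by Tonelli it is
   the integral against m-dimensional Lebesgue measure of any nonnegative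
   Borel function. *)
Fixpoint lebesgue_iter (R : realType) (m : nat) :
    ('rV[R]_m -> \bar R) -> \bar R :=
  match m with
  | 0 => fun f => f 0
  | n.+1 => fun f =>
      (\int[lebesgue_measure]_(x in [set: R])
         lebesgue_iter (fun y : 'rV[R]_n =>
           f (row_mx (const_mx x : 'rV[R]_1) y)))%E
  end.

Definition borel (M : ptopologicalType) := g_sigma_algebraType (@open M).

(* The Riemannian measure is the Borel measure given in every chart by
   sqrt (det g) dy; this determines mu uniquely, M being second countable. *)
Definition riemannian_measure (R : realType) (m : nat) (M : ptopologicalType)
    (X : riemannianManifold R m M)
    (mu : {measure set (borel M) -> \bar R}) : Prop :=
  forall (c : chart R m M) (A : set (borel M)),
    atlas X c -> measurable A -> A `<=` dom c ->
    mu A = lebesgue_iter (fun y =>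
      (\1_(coord c @` A) y * Num.sqrt (\det (metric X c (param c y))))%:E).

Definition smooth_fun (R : realType) (m : nat) (M : topologicalType)
    (X : riemannianManifold R m M) (phi : M -> R) : Prop :=
  forall c, atlas X c -> smooth_on (chart_range c) (phi \o param c).

(* |grad phi|^2 = g^{ij} (d_i phi) (d_j phi) *)
Definition grad_sq (R : realType) (m : nat) (M : topologicalType)
    (X : riemannianManifold R m M) (phi : M -> R) (x : M) : R :=
  let c := chart_at X x in
  let dphi : 'rV[R]_m :=
    \row_i 'D_(delta_mx 0 i) (phi \o param c) (coord c x) in
  (dphi *m invmx (metric X c x) *m dphi^T) 0 0.

(* C_c^oo(U), the functions being extended by 0 to M *)
Definition test_fun (R : realType) (m : nat) (M : topologicalType)
    (X : riemannianManifold R m M) (U : set M) (phi : M -> R) : Prop :=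
  let supp := closure [set x | phi x != 0] in
  [/\ smooth_fun X phi, compact supp & supp `<=` U].

Definition layer (R : realType) (m : nat) (M : topologicalType)
    (X : riemannianManifold R m M) (Omega : set M) (delta : R) : set M :=
  [set x | Omega x /\ (bdist X Omega x < delta%:E)%E].

Definition inner_set (R : realType) (m : nat) (M : topologicalType)
    (X : riemannianManifold R m M) (Omega : set M) (delta : R) : set M :=
  Omega `\` closure (layer X Omega delta).

Definition rayleigh (R : realType) (M : ptopologicalType) (m : nat)
    (X : riemannianManifold R m M) (mu : {measure set (borel M) -> \bar R})
    (V : M -> R) (U : set M) (phi : M -> R) : R :=
  (\int[mu]_(x in (U : set (borel M))) grad_sq X phi x) /
  (\int[mu]_(x in (U : set (borel M))) (V x * phi x ^+ 2)).

(* Extended-real valued: the infimum is +oo when there is no admissible phi,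
   e.g. when inner_set X Omega delta is empty. *)
Definition lambda_ (R : realType) (M : ptopologicalType) (m : nat)
    (X : riemannianManifold R m M) (mu : {measure set (borel M) -> \bar R})
    (V : M -> R) (Omega : set M) (delta : R) : \bar R :=
  let U := inner_set X Omega delta in
  ereal_inf [set (rayleigh X mu V U phi)%:E | phi in
    [set phi : M -> R | test_fun X U phi /\ exists x, phi x != 0]].

Definition bar_lambda (R : realType) (M : ptopologicalType) (m : nat)
    (X : riemannianManifold R m M) (mu : {measure set (borel M) -> \bar R})
    (V : M -> R) (Omega : set M) : \bar R :=
  lim (lambda_ X mu V Omega delta @[delta --> 0^'+]).

(* Main.v *)
From HB Require Import structures.
From mathcomp Require Import all_boot all_order all_algebra.
From mathcomp Require Import all_classical all_reals all_analysis.
From mathcomp Require Import measurable_realfun ring lra.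
Require Import Defs.
Import Order.TTheory GRing.Theory Num.Theory.
Import numFieldNormedType.Exports.
Local Open Scope classical_set_scope.
Local Open Scope ring_scope.
Set Implicit Arguments.
Unset Strict Implicit.

(** Scaling drives the proof.  Put a test function that lives on a cube of
    size rho sitting at distance comparable to rho from the boundary of Omega.
    Its gradient has size 1/rho, whereas V is at least of order rho^(- beta0)
    on that cube, and the volumes of the cube and of the smaller cube on which
    the test function is bounded below are comparable.  The Rayleigh quotient
    is therefore at most a constant times rho^(beta0 - 2), which tends to 0
    with rho since beta0 > 2.  A function with compact support in Omega is
    admissible in inner_set delta for every small delta, so lambda_ delta is
    eventually below any positive number; being nonnegative, it tends to 0.

    The boundary is not empty: otherwise the distance to it is +oo, whose
    finite part is 0, and 0 to a nonzero power is 0, so that the upper bound on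
    V contradicts V > 0.  The same argument shows that the distance is positive
    and finite on Omega.

    Everything takes place in one chart around a boundary point p.
    chart_local_bounds bounds the metric, its inverse and its volume density
    near p, uniformly in rho.  cube_near_boundary finds the cube: take a point
    of Omega very close to p, the nearest point z outside Omega in the chart,
    and a cube whose size is half of the distance to z; straight segments
    ending at z bound the Riemannian distance to the boundary by a multiple of
    rho.  derive_cutoff_bounded and cutoff_lower_bound describe the cutoff
    obtained from exp(-1/t) by translation and dilation, and
    rayleigh_chart_cutoff_le bounds its Rayleigh quotient.  The lower bound on
    V keeps the support away from the layers of small width
    (compact_sub_inner_set): where V is bounded, the distance to the boundary
    is bounded below.

    Integrals are only compared, never computed, except those of constants and
    indicators: the integral of a nonnegative function is a supremum over the
    simple functions below it, hence monotone for arbitrary nonnegative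
    integrands. *)

(** * Functions of class C^k *)

Lemma near_eq_continuous_at (V W : topologicalType) (f g : V -> W) (x : V) :
  (\forall y \near x, f y = g y) ->
  {for x, continuous f} -> {for x, continuous g}.
Proof.
move=> fg cf; rewrite /prop_for /continuous_at -(nbhs_singleton fg).
by apply: cvg_trans cf; exact: near_eq_cvg.
Qed.

(** The difference of the two functions vanishes near x, so it is a little-o of
    everything and has differential 0. *)
Lemma near_eq_differentiable (R : realType) (V W : normedModType R)
    (f g : V -> W) (x : V) :
  (\forall y \near x, f y = g y) -> differentiable f x -> differentiable g x.
Proof.
move=> fg df.
have gE : g = f + (g - f) by apply/funext => y; rewrite !fctE addrC subrK.
rewrite gE; apply: differentiableD => //.
set h := g - f; have h0 : \forall y \near x, h y = 0.
  by apply: filterS fg => y; rewrite /h !fctE => ->; rewrite subrr.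
have hx0 : h x = 0 by exact: nbhs_singleton h0.
have h_o : h \o shift x = cst (h x) + \0 +o_ 0 id.
  apply/eqaddoP => e e0; have h0' : \forall y \near (0 : V), h (y + x) = 0.
    move: h0; rewrite (near_shift 0) => /=; apply: filterS => y.
    by rewrite subr0 /=.
  apply: filterS h0' => y hy.
  rewrite !fctE /= hy hx0 addr0 subr0 normr0.
  by rewrite mulr_ge0// ltW.
have c0 : continuous (\0 : V -> W) by move=> z; exact: cst_continuous.
have d0 : 'd h x = \0 :> (V -> W) by exact: (diff_unique c0 h_o).
by apply/diff_locallyP; rewrite d0.
Qed.
Lemma Ck_on_pred (R : realType) (m : nat) (W : normedModType R) (k : nat)
    (U : set 'rV[R]_m) (f : 'rV[R]_m -> W) :
  Ck_on k.+1 U f -> Ck_on k U f.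
Proof.
elim: k f => [|k IH] f [df Df] /=.
  by move=> x Ux; apply: differentiable_continuous; exact: df.
by split=> // i; exact/IH/Df.
Qed.

(** Allows a function on a manifold to be shown smooth by different arguments
    near different points. *)
Lemma Ck_on_local (R : realType) (m : nat) (W : normedModType R) (k : nat)
    (U : set 'rV[R]_m) (f : 'rV[R]_m -> W) :
  (forall x, U x -> exists2 N : set 'rV[R]_m, N x & Ck_on k N f) ->
  Ck_on k U f.
Proof.
elim: k f => [|k IH] f loc /=.
  by move=> x /loc[N Nx h]; exact: h.
split=> [x /loc[N Nx [df _]]|i]; first exact: df.
by apply: IH => x /loc[N Nx [_ Df]]; exists N => //; exact: Df.
Qed.

Lemma eq_Ck_on (R : realType) (m : nat) (W : normedModType R) (k : nat)
    (U : set 'rV[R]_m) (f g : 'rV[R]_m -> W) : open U ->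
  (forall x, U x -> f x = g x) -> Ck_on k U f -> Ck_on k U g.
Proof.
move=> oU; elim: k f g => [|k IH] f g fg /=.
  move=> h x Ux; apply: near_eq_continuous_at (h x Ux).
  by apply: filterS (open_nbhs_nbhs (conj oU Ux)) => y /fg.
have near_fg x : U x -> \forall y \near x, f y = g y.
  by move=> Ux; apply: filterS (open_nbhs_nbhs (conj oU Ux)) => y /fg.
move=> [df Df]; split=> [x Ux|i].
  exact: (near_eq_differentiable (near_fg x Ux) (df x Ux)).
apply: IH (Df i) => x Ux; exact: near_eq_derive (near_fg x Ux).
Qed.
Lemma Ck_on_cst (R : realType) (m : nat) (W : normedModType R) (k : nat)
    (U : set 'rV[R]_m) (a : W) : Ck_on k U (cst a).
Proof.
elim: k a => [|k IH] a /=; first by move=> x _; exact: cst_continuous.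
split=> [x _|i]; first exact: differentiable_cst.
rewrite (_ : (fun x => 'D_(delta_mx 0 i) _ x) = cst 0); first exact: IH.
by apply/funext => x; exact: derive_cst.
Qed.

Lemma Ck_onD (R : realType) (m : nat) (W : normedModType R) (k : nat)
    (U : set 'rV[R]_m) (f g : 'rV[R]_m -> W) : open U ->
  Ck_on k U f -> Ck_on k U g -> Ck_on k U (f \+ g).
Proof.
move=> oU; elim: k f g => [|k IH] f g /=.
  by move=> cf cg x Ux; apply: continuousD; [exact: cf|exact: cg].
move=> [df Df] [dg Dg]; split=> [x Ux|i].
  by apply: differentiableD; [exact: df|exact: dg].
apply: eq_Ck_on (IH _ _ (Df i) (Dg i)) => // x Ux.
by rewrite deriveD//; apply: diff_derivable; [exact: df|exact: dg].
Qed.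

(** Leibniz rule: a partial derivative of the product involves the factors
    themselves, which are only known to be C^(k+1), hence Ck_on_pred. *)
Lemma Ck_onM (R : realType) (m : nat) (k : nat)
    (U : set 'rV[R]_m) (f g : 'rV[R]_m -> R) : open U ->
  Ck_on k U f -> Ck_on k U g -> Ck_on k U (f \* g).
Proof.
move=> oU; elim: k f g => [|k IH] f g.
  by move=> cf cg x Ux; apply: continuousM; [exact: cf|exact: cg].
move=> Cf Cg; have [df Df] := Cf; have [dg Dg] := Cg; split=> [x Ux|i].
  by apply: differentiableM; [exact: df|exact: dg].
have := Ck_onD oU (IH _ _ (Ck_on_pred Cf) (Dg i))
                  (IH _ _ (Ck_on_pred Cg) (Df i)).
apply: eq_Ck_on => // x Ux.
by rewrite deriveM//; apply: diff_derivable; [exact: df|exact: dg].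
Qed.

Lemma Ck_on_sum (R : realType) (m : nat) (k n : nat)
    (U : set 'rV[R]_m) (f : 'I_n -> 'rV[R]_m -> R) : open U ->
  (forall i, Ck_on k U (f i)) -> Ck_on k U (fun x => \sum_(i < n) f i x).
Proof.
move=> oU; elim: n f => [|n IH] f Cf.
  by under eq_fun do rewrite big_ord0; exact: Ck_on_cst.
under eq_fun do rewrite big_ord_recr /=.
by apply: Ck_onD => //; exact: IH.
Qed.

Lemma Ck_on_coord (R : realType) (m : nat) (k p q : nat) (U : set 'rV[R]_m)
    (F : 'rV[R]_m -> 'M[R]_(p, q)) (i : 'I_p) (j : 'I_q) : open U ->
  Ck_on k U F -> Ck_on k U (fun x => F x i j).
Proof.
move=> oU; elim: k F => [|k IH] F /=.
  move=> cF x Ux.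
  apply: (@continuous_comp _ _ _ F (fun M : 'M[R]_(p, q) => M i j)).
    exact: cF.
  exact: matrix_normedtype.coord_continuous.
move=> [dF DF]; split=> [x Ux|l].
  apply: (@differentiable_comp _ _ _ _ F (fun M : 'M[R]_(p, q) => M i j)).
    exact: dF.
  exact: differentiable_coord.
apply: eq_Ck_on (IH _ (DF l)) => // x Ux.
by rewrite derive_mx ?mxE//; apply: diff_derivable; exact: dF.
Qed.

(** The whole sequence of successive derivatives of the outer function is
    carried along, since differentiating h n at p leaves h n.+1 at p as a new
    outer function. *)
Lemma Ck_on_comp1 (R : realType) (m : nat) (k : nat) (U : set 'rV[R]_m)
    (h : nat -> R -> R) (p : 'rV[R]_m -> R) (n : nat) : open U ->
  (forall n (x : R), is_derive x 1 (h n) (h n.+1 x)) ->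
  Ck_on k U p -> Ck_on k U (h n \o p).
Proof.
move=> oU dh.
have diffh l x : differentiable (h l) x.
  by apply/derivable1_diffP; have [] := dh l x.
elim: k n p => [|k IH] n p.
  move=> cp x Ux; apply: continuous_comp; first exact: cp.
  exact: differentiable_continuous.
move=> Cp; have [dp Dp] := Cp; split=> [x Ux|i].
  by apply: differentiable_comp => //; exact: dp.
apply: eq_Ck_on (Ck_onM oU (IH n.+1 p (Ck_on_pred Cp)) (Dp i)) => // x Ux.
rewrite deriveE; last by apply: differentiable_comp => //; exact: dp.
rewrite diff_comp//; last exact: dp.
rewrite deriv1E /=; last by have [] := dh n (p x).
rewrite derive1E (@derive_val _ _ _ _ _ _ _ (dh n (p x))) -deriveE.
  by rewrite mulrC.
exact: dp.
Qed.

(** * A smooth cutoff supported in a cube *)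

(** The exponential series dominates each monomial: u^n <= n! e^u. *)
Lemma horner_mul_expRN_bounded (R : realType) (Q : {poly R}) :
  exists C : R, forall u, 0 <= u -> `|Q.[u]| * expR (- u) <= C.
Proof.
have monom n (u : R) : 0 <= u -> u ^+ n * expR (- u) <= n`!%:R.
  move=> u0; rewrite expRN ler_pdivrMr ?expR_gt0//.
  case: n => [|n].
    by rewrite expr0 mul1r (le_trans _ (expR_ge1Dx u))// lerDl.
  have f0 : 0 < (n.+1)`!%:R :> R by rewrite ltr0n fact_gt0.
  rewrite mulrC -ler_pdivrMr// (le_trans _ (expR_ge1Dxn n u0))//.
  by rewrite lerDr.
exists (\sum_(i < size Q) `|Q`_i| * i`!%:R) => u u0.
rewrite horner_coef (le_trans (ler_wpM2r (expR_ge0 _) (ler_norm_sum _ _ _)))//.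
rewrite mulr_suml ler_sum// => i _.
by rewrite normrM -mulrA ler_wpM2l// normrX (ger0_norm u0) monom.
Qed.

(** The functions P(1/x) exp(-1/x), extended by 0 to the nonpositive reals, are
    stable under differentiation; this is what makes exp(-1/x) smooth at 0. *)
Definition flat_poly (R : realType) (P : {poly R}) (x : R) : R :=
  if 0 < x then P.[x^-1] * expR (- x^-1) else 0.

Lemma is_derive_quadratic_bound (R : realType) (f : R -> R) (C : R) :
  (forall h, `|f h| <= C * h ^+ 2) -> is_derive (0 : R) 1 f 0.
Proof.
move=> fC.
have f0 : f 0 = 0.
  by apply/eqP; rewrite -normr_le0 (le_trans (fC 0))// expr0n mulr0.
have cv : (h^-1 *: ((f \o shift 0) (h *: (1 : R)) - f 0)) @[h --> 0^'] -->
    (0 : R).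
  apply/cvgr0Pnorm_le => e e0.
  have C1 : 0 < `|C| + 1 by rewrite ltr_wpDl.
  near=> h.
  have h0 : h != 0 by near: h; exact: nbhs_dnbhs_neq.
  rewrite f0 subr0 /= addr0 [h *: 1]mulr1 normrM normfV.
  rewrite mulrC ler_pdivrMr ?normr_gt0// (le_trans (fC h))//.
  rewrite -normr_id -[_ ^+ 2]ger0_norm ?sqr_ge0// normrX expr2 normr_id mulrA.
  rewrite ler_wpM2r// (@le_trans _ _ ((`|C| + 1) * `|h|))//.
    rewrite ler_wpM2r// (le_trans (ler_norm _))// lerDl//.
  rewrite mulrC -ler_pdivlMr//; near: h.
  by apply: dnbhs0_le; rewrite divr_gt0.
by split; [apply/cvg_ex; exists 0|exact: cvg_lim].
Unshelve. all: by end_near. Qed.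

(** At 0 the growth bound for P 'X^2 at 1/h makes the function O(h^2), so its
    derivative vanishes there. *)
Lemma is_derive_flat_poly (R : realType) (P : {poly R}) (x : R) :
  is_derive x 1 (flat_poly P) (flat_poly ('X^2 * (P - P^`())) x).
Proof.
have [x0|x0|->] := ltgtP x 0.
- rewrite {2}/flat_poly ltNge (ltW x0) /=.
  apply: (near_eq_is_derive (f := cst 0)) => //.
  near=> y; rewrite /flat_poly ltNge (_ : y <= 0)//.
  by apply/ltW; near: y; exact: lt_nbhsl.
- rewrite {2}/flat_poly x0.
  apply: (near_eq_is_derive
    (f := (horner P \o GRing.inv) * (expR \o (- (GRing.inv : R -> R))))).
    near=> y; rewrite /flat_poly !fctE /= ifT//.
    by near: y; exact: lt_nbhsr.
  have dinv : is_derive x 1 (GRing.inv : R -> R) (- x ^- 2).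
    have := @is_deriveV R id x 1 1 (lt0r_neq0 x0) (is_derive_id _ _).
    by rewrite [_ *: _]mulr1.
  have dP := @is_derive1_comp R (horner P) _ _ _ _ (is_derive_poly P _) dinv.
  have dN : is_derive x 1 (- (GRing.inv : R -> R)) (- - x ^- 2).
    exact: is_deriveN.
  have dE := @is_derive1_comp R expR _ _ _ _ (is_derive_expR _) dN.
  apply: is_derive_eq (is_deriveM dP dE) _.
  rewrite !hornerE /= !fctE /GRing.scale /= opprK exprVn.
  by ring.
- rewrite {2}/flat_poly ltxx.
  have [C QC] := horner_mul_expRN_bounded (P * 'X^2).
  have C0 : 0 <= C by exact: le_trans (QC 0 (lexx _)).
  apply: (@is_derive_quadratic_bound _ _ C) => h; rewrite /flat_poly.
  case: ifPn => [h0|_]; last by rewrite normr0 mulr_ge0// sqr_ge0.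
  have := QC h^-1; rewrite invr_ge0 (ltW h0) => /(_ isT).
  move=> /(ler_wpM2r (sqr_ge0 h)); apply: le_trans.
  rewrite hornerM hornerXn [in leLHS]normrM [in leRHS]normrM.
  rewrite (ger0_norm (expR_ge0 _)) (ger0_norm (sqr_ge0 _)).
  rewrite le_eqVlt; apply/orP; left; apply/eqP; field.
  by rewrite gt_eqF.
Unshelve. all: by end_near. Qed.

(** The n-th derivative of exp(-1/x) extended by 0. *)
Definition flat_exp (R : realType) (n : nat) : R -> R :=
  flat_poly (iter n (fun P => 'X^2 * (P - P^`())) 1).

Lemma is_derive_flat_exp (R : realType) (n : nat) (x : R) :
  is_derive x 1 (flat_exp n) (flat_exp n.+1 x).
Proof. exact: is_derive_flat_poly. Qed.

(** The Euclidean ball of radius r fits in the sup-norm ball of radius r, so the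
    support is in the cube; the square of the Euclidean norm is used because it
    is a polynomial. *)
Definition cutoff (R : realType) (m : nat) (y0 : 'rV[R]_m) (r : R)
    (y : 'rV[R]_m) : R :=
  flat_exp 0 (1 - \sum_(i < m) ((y 0 i - y0 0 i) / r) ^+ 2).

Lemma Ck_on_cutoff (R : realType) (m k : nat) (U : set 'rV[R]_m)
    (F : 'rV[R]_m -> 'rV[R]_m) (y0 : 'rV[R]_m) (r : R) : open U ->
  Ck_on k U F -> Ck_on k U (cutoff y0 r \o F).
Proof.
move=> oU CF.
pose p x := 1 + \sum_(i < m)
  ((-1) * (((F x 0 i - y0 0 i) / r) * ((F x 0 i - y0 0 i) / r))).
rewrite (_ : _ \o _ = flat_exp 0 \o p); last first.
  apply/funext => x; rewrite /cutoff /p /=; congr (flat_exp 0 (1 + _)).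
  by rewrite -mulr_sumr mulN1r; under eq_bigr do rewrite expr2.
apply: Ck_on_comp1 => //; first exact: is_derive_flat_exp.
apply: Ck_onD => //; first exact: Ck_on_cst.
apply: Ck_on_sum => // i; apply: Ck_onM => //; first exact: Ck_on_cst.
have Cp : Ck_on k U (fun x => (F x 0 i - y0 0 i) / r).
  apply: Ck_onM => //; last exact: Ck_on_cst.
  by apply: Ck_onD => //; [exact: Ck_on_coord|exact: Ck_on_cst].
exact: Ck_onM.
Qed.

Lemma cutoff_ge0 (R : realType) (m : nat) (y0 : 'rV[R]_m) (r : R)
    (y : 'rV[R]_m) :
  0 <= cutoff y0 r y.
Proof.
rewrite /cutoff /flat_exp /= /flat_poly; case: ifP => // _.
by rewrite hornerC mul1r expR_ge0.
Qed.

Lemma cutoff_eq0 (R : realType) (m : nat) (y0 : 'rV[R]_m) (r : R)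
    (y : 'rV[R]_m) :
  0 < r -> r < `|y - y0| -> cutoff y0 r y = 0.
Proof.
move=> r0 ry; rewrite /cutoff /flat_exp /= /flat_poly ifF//; apply/negbTE.
rewrite -leNgt subr_le0.
have [|i] := @mx_norm_neq0 _ _ _ (y - y0).
  by rewrite gt_eqF// (lt_trans r0).
rewrite -[mx_norm _]/(`|y - y0|) => e; move: ry; rewrite e !mxE ord1 => ry.
rewrite (bigD1 i.2)//= (@le_trans _ _ (((y 0 i.2 - y0 0 i.2) / r) ^+ 2))//.
  rewrite -real_normK ?num_real// -{1}(expr1n _ 2) ler_pXn2r ?nnegrE//.
  by rewrite normrM normfV (gtr0_norm r0) ler_pdivlMr// mul1r ltW.
by rewrite lerDl sumr_ge0// => j _; exact: sqr_ge0.
Qed.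

(** On a cube of radius s r with m s^2 <= 1/2 the argument of exp(-1/t) is at
    least 1/2. *)
Lemma cutoff_lower_bound (R : realType) (m : nat) :
  exists s a : R, [/\ 0 < s <= 1, 0 < a &
  forall (y0 y : 'rV[R]_m) (r : R), 0 < r -> `|y - y0| <= s * r ->
    a <= cutoff y0 r y].
Proof.
(* m s^2 <= s <= 1/2; m.+2 keeps this true when m = 0. *)
pose s : R := (m.+2%:R)^-1.
have s0 : 0 < s by rewrite invr_gt0 ltr0n.
have s1 : s <= 1/2 by rewrite mul1r lef_pV2 ?posrE ?ltr0n// ler_nat.
exists s, (expR (- 2)); split; [by rewrite s0 /=; lra|exact: expR_gt0|].
move=> y0 y r r0 yr.
have S : \sum_(i < m) ((y 0 i - y0 0 i) / r) ^+ 2 <= 1/2.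
  have le i : ((y 0 i - y0 0 i) / r) ^+ 2 <= s * s.
    rewrite -real_normK ?num_real// -expr2 ler_pXn2r ?nnegrE ?(ltW s0)//.
    rewrite normrM normfV (gtr0_norm r0) ler_pdivrMr// (le_trans _ yr)//.
    rewrite [leRHS]/Num.norm/= mx_normrE.
    by have := @le_bigmax _ _ _ 0 (fun i => `|(y - y0) i.1 i.2|) (0, i);
      rewrite !mxE.
  apply: (le_trans (ler_sum _ (fun i _ => le i))).
  rewrite sumr_const card_ord -[_ *+ m]mulr_natl mulrA.
  have : m%:R * s <= 1.
    by rewrite ler_pdivrMr ?ltr0n// mul1r ler_nat leqW.
  move=> ms; rewrite (@le_trans _ _ (1 * s))//; last by rewrite mul1r.
  by rewrite ler_wpM2r// ltW.
have S0 : 0 < 1 - \sum_(i < m) ((y 0 i - y0 0 i) / r) ^+ 2 by lra.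
rewrite /cutoff /flat_exp /= /flat_poly ifT// hornerC mul1r ler_expR lerN2.
by rewrite -(invrK 2) lef_pV2 ?posrE//; lra.
Qed.

Lemma derive_alongE (R : realType) (V W : normedModType R) (f : V -> W)
    (a v : V) : 'D_v f a = derive1 (fun h : R => f (h *: v + a)) 0.
Proof.
rewrite /derive /derive1; set d := (fun _ : R => _); set d' := (fun _ : R => _).
suff -> : d = d' by [].
by apply/funext => h; rewrite /d /d' /= addr0 scale0r add0r.
Qed.

(** Along a coordinate line the cutoff is flat_exp 0 composed with a quadratic
    polynomial, whose derivative is at most 2/r in absolute value at the points
    where flat_exp 1 does not vanish. *)
Lemma derive_cutoff_bounded (R : realType) (m : nat) : exists2 B : R, 0 <= B &
  forall (y0 y : 'rV[R]_m) (r : R) (i : 'I_m), 0 < r ->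
    `|'D_(delta_mx 0 i) (cutoff y0 r) y| <= B / r.
Proof.
have [C Cb] := @horner_mul_expRN_bounded R ('X^2 * (1 - (1 : {poly R})^`())).
have C0 : 0 <= C by exact: le_trans (Cb 0 (lexx _)).
exists (2 * C) => [|y0 y r i r0]; first by rewrite mulr_ge0.
set t := 1 - \sum_(j < m) ((y 0 j - y0 0 j) / r) ^+ 2.
pose a := (y 0 i - y0 0 i) / r.
have line h : cutoff y0 r (h *: delta_mx 0 i + y) =
    (flat_exp 0 \o
       horner (t%:P - (2 * a / r)%:P * 'X - (r^-1 ^+ 2)%:P * 'X^2)) h.
  rewrite /cutoff /=; congr (flat_exp 0 _).
  rewrite !hornerE /t /a (bigD1 i)//= [in RHS](bigD1 i)//=.
  rewrite (eq_bigr (fun j => ((y 0 j - y0 0 j) / r) ^+ 2)); last first.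
    move=> j ji; rewrite !mxE eqxx /= (negbTE ji).
    by rewrite mulr0 add0r.
  rewrite !mxE !eqxx /=; set S := \sum_(_ < _ | _) _; field.
  by rewrite gt_eqF.
rewrite derive_alongE (eq_fun line) derive1E.
rewrite (@derive_val _ _ _ _ _ _ _ (@is_derive1_comp R _ _ _ _ _
  (is_derive_flat_exp _ _) (is_derive_poly _ _))).
rewrite !poly.derivE /= !hornerE /=.
rewrite !(mulr0, addr0, mul0r, subr0, sub0r, expr0n, mulr1) /=.
rewrite /flat_exp /= /flat_poly; case: ifPn => [t0|_]; last first.
  by rewrite mul0r normr0 divr_ge0// ?mulr_ge0// ltW.
rewrite normrM (@le_trans _ _ (C * (2 / r)))//; last by rewrite mulrCA mulrA.
apply: ler_pM => //.
  rewrite normrM (ger0_norm (expR_ge0 _)); apply: Cb.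
  by rewrite invr_ge0 ltW.
rewrite normrN -[2 * _ / r]mulrA -/a mulrAC normrM.
rewrite ger0_norm ?divr_ge0 ?(ltW r0)// -[leRHS]mulr1.
rewrite ler_wpM2l ?divr_ge0 ?(ltW r0)//.
rewrite -(@ler_pXn2r _ 2)// ?nnegrE// real_normK ?num_real// expr1n.
move: t0; rewrite /t (bigD1 i)//= -/a.
have : 0 <= \sum_(j < m | j != i) ((y 0 j - y0 0 j) / r) ^+ 2.
  by rewrite sumr_ge0// => j _; exact: sqr_ge0.
lra.
Qed.

(** * Integrals of nonnegative functions and volumes of cubes *)

Lemma rV_norm_leP (R : realType) (m : nat) (v : 'rV[R]_m) (r : R) : 0 <= r ->
  (`|v| <= r) <-> (forall i, `|v 0 i| <= r).
Proof.
move=> r0; split=> [vr i|vr].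
  apply: le_trans vr; rewrite [leRHS]/Num.norm/= mx_normrE.
  exact: (@le_bigmax _ _ _ 0 (fun i => `|v i.1 i.2|) (0, i)).
rewrite /Num.norm/= mx_normrE; apply: bigmax_le => //= -[i j] _ /=.
by rewrite (ord1 i).
Qed.

(** The integral of a nonnegative function is the supremum of the integrals of
    the simple functions below it. *)
Lemma ge0_le_integral_nonmeasurable (d : measure_display)
    (T : measurableType d) (R : realType) (mu : {measure set T -> \bar R})
    (D : set T) (f g : T -> \bar R) :
  (forall x, D x -> (0 <= f x)%E) -> (forall x, D x -> (f x <= g x)%E) ->
  (\int[mu]_(x in D) f x <= \int[mu]_(x in D) g x)%E.
Proof.
move=> f0 fg.
have g0 x : D x -> (0 <= g x)%E by move=> Dx; rewrite (le_trans (f0 _ Dx))// fg.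
rewrite [leLHS]integral_mkcond [leRHS]integral_mkcond.
rewrite !ge0_integralTE//; try by move=> x; apply: erestrict_ge0.
apply: ub_ereal_sup => _ [h hf <-]; apply: ereal_sup_ubound.
exists h => // x.
by apply: (le_trans (hf x)); apply: lee_restrict.
Qed.

Lemma lebesgue_iter_ge0 (R : realType) (m : nat) (f : 'rV[R]_m -> \bar R) :
  (forall y, (0 <= f y)%E) -> (0 <= lebesgue_iter f)%E.
Proof.
elim: m f => [|m IH] f f0 /=; first exact: f0.
by apply: integral_ge0 => x _; exact: IH.
Qed.

Lemma le_lebesgue_iter (R : realType) (m : nat) (f g : 'rV[R]_m -> \bar R) :
  (forall y, (0 <= f y)%E) -> (forall y, (f y <= g y)%E) ->
  (lebesgue_iter f <= lebesgue_iter g)%E.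
Proof.
elim: m f g => [|m IH] f g f0 fg /=; first exact: fg.
apply: ge0_le_integral_nonmeasurable => x _; last exact: IH.
exact: lebesgue_iter_ge0.
Qed.

(** The indicator of a cube is a product of indicators of intervals, so that
    the iterated integral factors. *)
Lemma lebesgue_iter_cube (R : realType) (m : nat) (y0 : 'rV[R]_m) (r c : R) :
  0 <= r -> 0 <= c ->
  lebesgue_iter (fun y => (\1_[set y | `|y - y0| <= r] y * c)%:E) =
    ((2 * r) ^+ m * c)%:E.
Proof.
move=> r0; elim: m y0 c => [|m IH] y0 c c0 /=.
  rewrite expr0 indicE mem_set//=.
  by apply/(rV_norm_leP _ r0) => -[].
pose a : R := y0 0 0; pose z : 'rV_m := \row_j y0 0 (lift 0 j).
have cubeE (x : R) (y : 'rV_m) :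
    \1_[set y | `|y - y0| <= r] (row_mx (const_mx x : 'rV_1) y : 'rV_m.+1) =
    \1_(`[a - r, a + r]) x * \1_[set y | `|y - z| <= r] y :> R.
  rewrite !indicE -natrM mulnb; congr (_ %:R); congr nat_of_bool.
  apply/idP/andP; rewrite !inE /=.
    move/(rV_norm_leP _ r0) => h; split.
      have := h 0; rewrite !mxE; case: splitP => // j _; rewrite mxE -/a.
      by rewrite ler_distl in_itv.
    apply/(rV_norm_leP _ r0) => j; have := h (lift 0 j).
    rewrite !mxE; case: splitP => k /=.
      by rewrite (ord1 k) /bump.
    by move=> /eqP; rewrite /bump /= !add1n eqSS => /eqP/val_inj ->.
  move=> [ax /(rV_norm_leP _ r0) h]; apply/(rV_norm_leP _ r0) => j.
  rewrite !mxE; case: splitP => k jk.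
    rewrite mxE (_ : j = 0); last by apply/val_inj; rewrite /= jk (ord1 k).
    by rewrite ler_distl -/a; move: ax; rewrite in_itv.
  have := h k; rewrite !mxE (_ : lift 0 k = j)//.
  by apply/val_inj; rewrite /= jk /bump.
transitivity (\int[lebesgue_measure]_(x in [set: R])
    (((2 * r) ^+ m * c)%:E * (\1_(`[a - r, a + r]) x)%:E))%E.
  apply: eq_integral => x _.
  have c1 : 0 <= \1_(`[a - r, a + r]) x * c :> R by rewrite mulr_ge0.
  transitivity (((2 * r) ^+ m * (\1_(`[a - r, a + r]) x * c))%:E).
    rewrite -(IH z _ c1); congr lebesgue_iter.
    by apply/funext => y; rewrite cubeE mulrCA mulrA.
  by rewrite mulrCA mulrC EFinM.
rewrite ge0_integralZl_EFin//; last 2 first.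
  by apply/measurable_EFinP; exact: measurable_indic.
  by rewrite mulr_ge0// exprn_ge0// mulr_ge0.
rewrite integral_indic//= setIT lebesgue_measure_itv/= lte_fin.
case: ifPn => [_|].
  by rewrite -EFinD -EFinM exprS; congr EFin; set p := _ ^+ m; ring.
rewrite -leNgt => ar; rewrite (_ : r = 0) ?mulr0 ?expr0n ?mul0r ?mule0//.
by apply/eqP; rewrite eq_le r0 andbT; lra.
Qed.

(** * Continuity of matrix functions and positive definite matrices *)

Lemma open_setI_preimage (T U : topologicalType) (A : set T) (B : set U)
    (f : T -> U) : open A -> open B ->
  (forall x, A x -> {for x, continuous f}) -> open (A `&` f @^-1` B).
Proof.
move=> oA oB cf; rewrite openE => x [Ax Bfx]; apply: filterI.
  exact: open_nbhs_nbhs.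
by apply: (cf x Ax); exact: open_nbhs_nbhs.
Qed.

Lemma eq_continuous_at (V W : topologicalType) (f g : V -> W) (x : V) :
  f =1 g -> {for x, continuous f} -> {for x, continuous g}.
Proof. by move=> /funext ->. Qed.

Lemma continuous_at_sum (R : realType) (T : topologicalType)
    (W : normedModType R) (I : Type) (r : seq I) (f : I -> T -> W) (x : T) :
  (forall i, {for x, continuous (f i)}) ->
  {for x, continuous (fun y => \sum_(i <- r) f i y)}.
Proof.
move=> cf; elim: r => [|i r IH].
  apply: (@eq_continuous_at _ _ (cst (0 : W))); last exact: cst_continuous.
  by move=> y; rewrite big_nil.
apply: (@eq_continuous_at _ _ (fun y => f i y + \sum_(i <- r) f i y));
  first by move=> y; rewrite big_cons.
by apply: continuousD; [exact: cf|exact: IH].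
Qed.

Lemma continuous_at_prod (R : realType) (T : topologicalType) (I : Type)
    (r : seq I) (f : I -> T -> R) (x : T) :
  (forall i, {for x, continuous (f i)}) ->
  {for x, continuous (fun y => \prod_(i <- r) f i y)}.
Proof.
move=> cf; elim: r => [|i r IH].
  apply: (@eq_continuous_at _ _ (cst (1 : R))); last exact: cst_continuous.
  by move=> y; rewrite big_nil.
apply: (@eq_continuous_at _ _ (fun y => f i y * \prod_(i <- r) f i y));
  first by move=> y; rewrite big_cons.
by apply: continuousM; [exact: cf|exact: IH].
Qed.

Lemma continuous_at_det (R : realType) (T : topologicalType) (n : nat)
    (A : T -> 'M[R]_n) (x : T) :
  (forall i j, {for x, continuous (fun y => A y i j)}) ->
  {for x, continuous (fun y => \det (A y))}.
Proof.
move=> cA; apply: (@continuous_at_sum _ _ R^o) => s.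
apply: continuousM; first exact: cst_continuous.
by apply: continuous_at_prod => i; exact: cA.
Qed.

(** Cramer's rule expresses the inverse by determinants. *)
Lemma continuous_at_invmx (R : realType) (T : topologicalType) (n : nat)
    (A : T -> 'M[R]_n) (x : T) :
  (forall i j, {for x, continuous (fun y => A y i j)}) -> \det (A x) != 0 ->
  forall i j, {for x, continuous (fun y => invmx (A y) i j)}.
Proof.
move=> cA dA i j.
have cd := continuous_at_det cA.
apply: (near_eq_continuous_at
    (f := fun y => (\det (A y))^-1 * cofactor (A y) j i)).
  have : \forall y \near x, \det (A y) != 0 by exact: (cvgr_neq0 _ cd).
  by apply: filterS => y dy; rewrite /invmx unitmxE unitfE dy !mxE.
apply: continuousM; first exact: continuousV.
apply: continuousM; first exact: cst_continuous.
apply: continuous_at_det => k l.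
apply: (@eq_continuous_at _ _ (fun y => A y (lift j k) (lift i l))) => //.
by move=> y; rewrite !mxE.
Qed.

Lemma posdef_unitmx (R : realType) (n : nat) (A : 'M[R]_n) :
  (forall v : 'rV[R]_n, v != 0 -> 0 < (v *m A *m v^T) 0 0) -> A \in unitmx.
Proof.
move=> pA; rewrite -row_free_unit; apply: inj_row_free => v vA.
apply/eqP; apply: contraT => /pA.
by rewrite vA mul0mx mxE ltxx.
Qed.

(** The matrices (1 - t) I + t A are positive definite, hence invertible, for t
    in [0, 1]; the determinant is 1 at t = 0 and cannot change sign. *)
Lemma posdef_det_gt0 (R : realType) (n : nat) (A : 'M[R]_n) :
  (forall v : 'rV[R]_n, v != 0 -> 0 < (v *m A *m v^T) 0 0) -> 0 < \det A.
Proof.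
move=> pA; pose B (t : R) : 'M[R]_n := (1 - t)%:M + t *: A.
have normv (v : 'rV[R]_n) : v != 0 -> 0 < (v *m v^T) 0 0.
  move=> v0; rewrite mxE; have /rV0Pn[i vi] := v0.
  rewrite (bigD1 i)//= mxE ltr_wpDr//.
    by apply: sumr_ge0 => j _; rewrite mxE -expr2 sqr_ge0.
  by rewrite -expr2 exprn_even_gt0.
have detB t : 0 <= t <= 1 -> \det (B t) != 0.
  move=> /andP[t0 t1]; rewrite -unitfE -unitmxE; apply: posdef_unitmx => v v0.
  rewrite /B mulmxDr mulmxDl mul_mx_scalar -!scalemxAl -scalemxAr -scalemxAl.
  rewrite !mxE.
  have := pA v v0; have := normv v v0; rewrite !mxE.
  move: (\sum_(_ < _) _) (\sum_(_ < _) _) => a b a0 b0.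
  have [->|tn0] := eqVneq t 0; first by rewrite subr0 mul1r mul0r addr0.
  rewrite ltr_wpDl//; first by rewrite mulr_ge0 ?subr_ge0// ltW.
  by rewrite mulr_gt0// lt_def tn0.
have cB : continuous (fun t => \det (B t)).
  move=> t; apply: continuous_at_det => i j.
  apply: (@eq_continuous_at _ _
    (fun t : R => (1 - t) * (i == j)%:R + t * A i j)).
    by move=> u; rewrite !mxE mulr_natr.
  apply: continuousD; apply: continuousM; try exact: cst_continuous.
    by apply: continuousB; [exact: cst_continuous|exact: id].
  exact: id.
have B0 : \det (B 0) = 1 by rewrite /B subr0 scale0r addr0 det1.
have B1 : \det (B 1) = \det A by rewrite /B subrr scale1r raddf0 add0r.
rewrite ltNge; apply/negP => dA0.
have [||t] := @IVT R (fun t => \det (B t)) 0 1 0 ler01.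
- by apply: continuous_subspaceT => ?; exact: cB.
- by rewrite B0 B1 ge_min le_max dA0 ler01 orbT.
by rewrite in_itv /= => /detB/eqP.
Qed.

(** With w = v A^-1 and A symmetric, v A^-1 v^T = w A w^T. *)
Lemma posdef_invmx_ge0 (R : realType) (n : nat) (A : 'M[R]_n) (v : 'rV[R]_n) :
  A^T = A -> (forall v : 'rV[R]_n, v != 0 -> 0 < (v *m A *m v^T) 0 0) ->
  0 <= (v *m invmx A *m v^T) 0 0.
Proof.
move=> sA pA; have uA := posdef_unitmx pA.
set w := v *m invmx A.
have -> : v = w *m A by rewrite /w mulmxKV.
rewrite trmx_mul sA mulmxA.
have [->|/pA/ltW//] := eqVneq w 0.
by rewrite !mul0mx mxE.
Qed.

Lemma quadratic_form_le (R : realType) (n : nat) (A : 'M[R]_n) (v : 'rV[R]_n)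
    (K B : R) : 0 <= K -> (forall i j, `|A i j| <= K) ->
  (forall i, `|v 0 i| <= B) ->
  (v *m A *m v^T) 0 0 <= n%:R ^+ 2 * K * B ^+ 2.
Proof.
move=> K0 AK vB; rewrite mxE.
have le1 i : (v *m A) 0 i * v^T i 0 <= n%:R * K * B ^+ 2.
  have B0 : 0 <= B by exact: le_trans (vB i).
  rewrite (le_trans (ler_norm _))// normrM expr2 mulrA !mxE ler_pM//.
  rewrite (le_trans (ler_norm_sum _ _ _))//.
  rewrite (le_trans (ler_sum _ (G := fun=> K * B) _))//.
    by move=> j _; rewrite normrM mulrC ler_pM.
  by rewrite sumr_const card_ord -[_ *+ n]mulr_natl mulrA.
rewrite (le_trans (ler_sum _ (fun i _ => le1 i)))//.
by rewrite sumr_const card_ord -[_ *+ n]mulr_natl !mulrA.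
Qed.

(** * Changes of chart, gradients and coordinate segments *)

Lemma chart_rangeP (R : realType) (m : nat) (M : topologicalType)
    (c : chart R m M) (y : 'rV[R]_m) : chart_range c y ->
  dom c (param c y) /\ coord c (param c y) = y.
Proof. by move=> [x cx <-]; rewrite coordK. Qed.

Lemma chart_overlapE (R : realType) (m : nat) (M : topologicalType)
    (c c' : chart R m M) :
  coord c @` (dom c `&` dom c') = chart_range c `&` param c @^-1` dom c'.
Proof.
apply/seteqP; split=> y.
  by move=> [x [cx c'x] <-]; split; [exists x|rewrite /= coordK].
by move=> [/chart_rangeP[cy ey] c'y]; exists (param c y).
Qed.

Lemma chart_overlap_open (R : realType) (m : nat) (M : topologicalType)
    (c c' : chart R m M) : open (coord c @` (dom c `&` dom c')).
Proof.
rewrite chart_overlapE; apply: open_setI_preimage.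
- exact: range_open.
- exact: dom_open.
- exact: param_continuous.
Qed.

Section transition.
Context (R : realType) (m : nat) (M : topologicalType)
  (X : riemannianManifold R m M).
Implicit Types c : chart R m M.

Lemma metric_unitmx c x : atlas X c -> dom c x -> metric X c x \in unitmx.
Proof. by move=> ac cx; apply: posdef_unitmx => v; exact: metric_posdef. Qed.

Lemma transition_differentiable c c' y : atlas X c -> atlas X c' ->
  (coord c @` (dom c `&` dom c')) y -> differentiable (coord c' \o param c) y.
Proof.
move=> ac ac' oy; have [+ _] := atlas_compatible ac ac' 1%N.
by apply.
Qed.

Lemma transition_jacobian_unitmx c c' x : atlas X c -> atlas X c' ->
  dom c x -> dom c' x -> 'J (coord c' \o param c) (coord c x) \in unitmx.
Proof.
move=> ac ac' cx c'x; have := metric_unitmx ac cx.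
rewrite (metric_compatible ac ac' cx c'x).
by rewrite !unitmx_mul => /andP[/andP[]].
Qed.

Definition chart_grad (phi : M -> R) c (x : M) : 'rV[R]_m :=
  \row_i 'D_(delta_mx 0 i) (phi \o param c) (coord c x).

(** Chain rule; gradients, written as rows of partial derivatives, transform by
    the transposed Jacobian. *)
Lemma chart_grad_transition c c' (phi : M -> R) x : atlas X c -> atlas X c' ->
  dom c x -> dom c' x -> smooth_fun X phi ->
  chart_grad phi c x =
    chart_grad phi c' x *m ('J (coord c' \o param c) (coord c x))^T.
Proof.
move=> ac ac' cx c'x sphi; set F := coord c' \o param c.
have ox : (coord c @` (dom c `&` dom c')) (coord c x) by exists x.
have dF : differentiable F (coord c x) by exact: transition_differentiable ox.
have Fx : F (coord c x) = coord c' x by rewrite /F /= coordK.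
have dphi : differentiable (phi \o param c') (F (coord c x)).
  by have [+ _] := sphi c' ac' 1%N; apply; rewrite Fx; exists x.
apply/rowP => i; rewrite !mxE.
have -> : 'D_(delta_mx 0 i) (phi \o param c) (coord c x) =
    'D_(delta_mx 0 i) ((phi \o param c') \o F) (coord c x).
  apply: near_eq_derive.
  have := open_nbhs_nbhs (conj (@chart_overlap_open _ _ _ c c') ox).
  apply: filterS => y; rewrite chart_overlapE => -[_ c'y].
  by rewrite /F /= coordK.
rewrite deriveE; last exact: differentiable_comp.
rewrite diff_comp//= [X in 'd _ _ X]row_sum_delta linear_sum.
apply: eq_bigr => j _; rewrite linearZ /= mulrC [in RHS]mxE [X in _ = _ * X]mxE.
congr (_ * _); last by rewrite -Fx deriveE.
rewrite -deriveE// deriveEjacobian// mxE (bigD1 i)//= big1 ?addr0; last first.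
  by move=> k ki; rewrite mxE (negbTE ki) andbF mul0r.
by rewrite mxE !eqxx mul1r.
Qed.

(** In the change of chart the Jacobian factors of the gradient cancel those of
    the inverse metric. *)
Lemma grad_sqE c (phi : M -> R) x : atlas X c -> dom c x -> smooth_fun X phi ->
  grad_sq X phi x =
    (chart_grad phi c x *m invmx (metric X c x) *m (chart_grad phi c x)^T) 0 0.
Proof.
move=> ac cx sphi.
have ac' := chart_at_atlas X x; have c'x := chart_at_dom X x.
rewrite /grad_sq -/(chart_grad phi (chart_at X x) x).
move: (chart_at X x) ac' c'x => c' ac' c'x.
rewrite (chart_grad_transition ac ac' cx c'x sphi).
rewrite (metric_compatible ac ac' cx c'x) /=.
have uJ := transition_jacobian_unitmx ac ac' cx c'x.
have ug := metric_unitmx ac' c'x.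
move: ('J _ _) uJ => J uJ; move: (metric X c' x) ug => g ug.
move: (chart_grad phi c' x) => w.
rewrite trmx_mul trmxK !mulmxA.
have -> : invmx (J *m g *m J^T) = invmx J^T *m invmx g *m invmx J.
  have uJT : J^T \in unitmx by rewrite unitmx_tr.
  have uB : J *m g *m J^T \in unitmx by rewrite !unitmx_mul uJ ug.
  apply: (can_inj (mulmxK uB)).
  by rewrite mulVmx// !mulmxA mulmxKV// mulmxKV// mulVmx.
by rewrite !mulmxA mulmxK ?unitmx_tr// mulmxKV.
Qed.

Lemma grad_sq_ge0 (phi : M -> R) x : 0 <= grad_sq X phi x.
Proof.
rewrite /grad_sq; apply: posdef_invmx_ge0.
  by apply: (metric_sym (chart_at_atlas X x)); exact: chart_at_dom.
move=> v v0; apply: metric_posdef => //; first exact: chart_at_atlas.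
exact: chart_at_dom.
Qed.

Definition segment (a v : 'rV[R]_m) (t : R) : 'rV[R]_m := a + t *: v.

Lemma is_derive_segment (a v : 'rV[R]_m) (t : R) :
  is_derive t (1 : R) (segment a v) v.
Proof.
have -> : segment a v = cst a + ( *:%R^~ v) by [].
have ds : is_diff t (cst a + ( *:%R^~ v)) (0 + ( *:%R^~ v)) by exact: is_diffD.
have [dS DS] := ds.
split; first exact: diff_derivable.
by rewrite deriveE// DS /= add0r scale1r.
Qed.

Lemma segment_derivative c c' (a v : 'rV[R]_m) (t : R) :
  atlas X c -> atlas X c' ->
  (coord c @` (dom c `&` dom c')) (segment a v t) ->
  derivable (coord c' \o (param c \o segment a v)) t 1 /\
  derive1 (coord c' \o (param c \o segment a v)) t =
    v *m 'J (coord c' \o param c) (segment a v t).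
Proof.
move=> ac ac' ot; have dF := transition_differentiable ac ac' ot.
have [ds Ds] := is_derive_segment a v t.
move/derivable1_diffP : ds => ds.
have dFs : differentiable ((coord c' \o param c) \o segment a v) t.
  exact: differentiable_comp.
split; first exact/derivable1_diffP.
rewrite derive1E -[coord c' \o (_ \o _)]/((coord c' \o param c) \o segment a v).
rewrite deriveE// diff_comp//= -[X in 'd _ _ X]deriveE// Ds -deriveE//.
exact: deriveEjacobian.
Qed.

Lemma segment_continuous (a v : 'rV[R]_m) : continuous (segment a v).
Proof.
move=> t; have [/derivable1_diffP ds _] := is_derive_segment a v t.
exact: differentiable_continuous.
Qed.

(** In any other chart the velocity is a combination of the partial derivatives
    of the transition map along the segment, which are continuous. *)
Lemma segment_C1_curve c (a v : 'rV[R]_m) : atlas X c ->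
  (forall t, 0 <= t <= 1 -> chart_range c (segment a v t)) ->
  C1_curve X (param c \o segment a v).
Proof.
move=> ac rs t t01; have rt := rs t t01; split.
  apply: continuous_comp; first exact: segment_continuous.
  exact: param_continuous.
move=> c' ac' c't.
have ot : (coord c @` (dom c `&` dom c')) (segment a v t).
  by rewrite chart_overlapE.
have near_o : \forall s \near t,
    (coord c @` (dom c `&` dom c')) (segment a v s).
  apply: (@segment_continuous a v t).
  exact: open_nbhs_nbhs (conj (@chart_overlap_open _ _ _ c c') ot).
split.
  by apply: filterS near_o => s os; have [] := segment_derivative ac ac' os.
pose F := coord c' \o param c.
apply: (near_eq_continuous_at
    (f := fun s => \sum_(i < m) v 0 i *: 'D_(delta_mx 0 i) F (segment a v s))).
  apply: filterS near_o => s os; have [_ ->] := segment_derivative ac ac' os.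
  have dF := transition_differentiable ac ac' os.
  rewrite -deriveEjacobian// deriveE// [X in _ = 'd _ _ X]row_sum_delta.
  rewrite linear_sum.
  by apply: eq_bigr => i _; rewrite linearZ /= deriveE.
apply: continuous_at_sum => i.
apply: continuousZl_tmp.
apply: (@continuous_comp _ _ _ (segment a v) ('D_(delta_mx 0 i) F)).
  exact: segment_continuous.
have [_ CF] := atlas_compatible ac ac' 1%N.
exact: (CF i _ ot).
Qed.

Lemma segment_speed c (a v : 'rV[R]_m) (t : R) : atlas X c ->
  chart_range c (segment a v t) ->
  speed X (param c \o segment a v) t =
    Num.sqrt ((v *m metric X c (param c (segment a v t)) *m v^T) 0 0).
Proof.
move=> ac rt; have [ct et] := chart_rangeP rt.
set x := param c _; rewrite /speed -[(_ \o _) t]/x.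
have ac' := chart_at_atlas X x; have c'x := chart_at_dom X x.
move: (chart_at X x) ac' c'x => c' ac' c'x.
have ot : (coord c @` (dom c `&` dom c')) (segment a v t).
  by rewrite chart_overlapE.
have [_ ->] := segment_derivative ac ac' ot.
rewrite (metric_compatible ac ac' ct c'x) et trmx_mul.
by rewrite !mulmxA.
Qed.

Lemma piecewise_C1_ge0 x y l : piecewise_C1 X x y l -> (0 <= l)%E.
Proof.
elim=> // gamma z l' _ _ l'0; apply: adde_ge0 => //.
by apply: integral_ge0 => t _; rewrite lee_fin sqrtr_ge0.
Qed.

Lemma bdist_ge0 (Omega : set M) x : (0 <= bdist X Omega x)%E.
Proof.
apply: le_ereal_inf_tmp => _ [y _ <-]; apply: le_ereal_inf_tmp => l.
exact: piecewise_C1_ge0.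
Qed.

(** The speed is at most L on the unit time interval, so the length of the
    segment is at most L. *)
Lemma riem_dist_segment_le c (a v : 'rV[R]_m) (L : R) : atlas X c ->
  (forall t, 0 <= t <= 1 -> chart_range c (segment a v t)) ->
  (forall t, 0 <= t <= 1 ->
    (v *m metric X c (param c (segment a v t)) *m v^T) 0 0 <= L ^+ 2) ->
  0 <= L ->
  (riem_dist X (param c a) (param c (a + v)) <= L%:E)%E.
Proof.
move=> ac rs gL L0; set gamma := param c \o segment a v.
have Cg := segment_C1_curve ac rs.
have := piecewise_C1_cons Cg (piecewise_C1_nil X _).
rewrite adde0 => pg.
have -> : param c a = gamma 0 by rewrite /gamma /segment /= scale0r addr0.
have -> : param c (a + v) = gamma 1 by rewrite /gamma /segment /= scale1r.
apply: (@le_trans _ _ (curve_length X gamma)).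
  exact: ereal_inf_lbound.
apply: (@le_trans _ _
  (\int[lebesgue_measure]_(t in `[0%R, 1%R]) (cst L%:E t)))%E.
  apply: ge0_le_integral_nonmeasurable => t /=.
    by move=> _; rewrite lee_fin sqrtr_ge0.
  rewrite in_itv /= => t01; rewrite lee_fin segment_speed//; last exact: rs.
  by rewrite -(ger0_norm L0) -sqrtr_sqr ler_wsqrtr// gL.
rewrite integral_cst//= lebesgue_measure_itv /= lte_fin ltr01 -EFinB subr0.
by rewrite mule1.
Qed.
End transition.

(** * Uniform control of the metric near a point *)

Lemma near_bounded_entries (R : realType) (T : topologicalType) (p q : nat)
    (A : T -> 'M[R]_(p, q)) (x : T) :
  (forall i j, {for x, continuous (fun y => A y i j)}) ->
  exists2 K : R, 0 <= K & \forall y \near x, forall i j, `|A y i j| <= K.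
Proof.
move=> cA; exists (`|A x| + 1) => [|]; first by rewrite addr_ge0.
have near_ij i j : \forall y \near x, `|A y i j| <= `|A x| + 1.
  have le : `|A x i j| < `|A x| + 1.
    rewrite ltr_pwDr// [leRHS]/Num.norm/= mx_normrE.
    exact: (@le_bigmax _ _ _ 0 (fun k => `|A x k.1 k.2|) (i, j)).
  have cn : {for x, continuous (fun y => `|A y i j|)}.
    exact: cvg_norm (cA i j).
  have lt_near : \forall y \near x, `|A y i j| < `|A x| + 1.
    exact: (cvgr_lt _ cn).
  by apply: filterS lt_near => y lty; exact: ltW.
apply: filter_forall => i; apply: filter_forall => j; exact: near_ij.
Qed.

(** The metric, its inverse and the volume density are continuous at q, and the
    density is positive there. *)
Lemma chart_local_bounds (R : realType) (m : nat) (M : topologicalType)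
    (X : riemannianManifold R m M) (c : chart R m M) (q : 'rV[R]_m) :
  atlas X c -> chart_range c q ->
  exists r K w0 w1 : R,
    [/\ 0 < r, 0 < K, 0 < w0, 0 < w1 &
    forall y, `|y - q| < r ->
    [/\ chart_range c y,
        (forall (v : 'rV_m) (B : R), (forall i, `|v 0 i| <= B) ->
          (v *m metric X c (param c y) *m v^T) 0 0 <= (K * B) ^+ 2),
        (forall (v : 'rV_m) (B : R), (forall i, `|v 0 i| <= B) ->
          (v *m invmx (metric X c (param c y)) *m v^T) 0 0 <= (K * B) ^+ 2) &
        w0 <= Num.sqrt (\det (metric X c (param c y))) <= w1]].
Proof.
move=> ac rq; have [cq eq] := chart_rangeP rq.
pose g := metric X c \o param c.
have cg i j : {for q, continuous (fun y => g y i j)}.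
  have := metric_smooth ac 0%N.
  by move=> /(Ck_on_coord i j (@range_open _ _ _ c)) /(_ q rq).
have pg : 0 < \det (g q).
  by apply: posdef_det_gt0 => v; exact: metric_posdef.
have cdet := continuous_at_det cg.
have [K1 K10 nK1] := near_bounded_entries cg.
have [K2 K20 nK2] := near_bounded_entries
  (continuous_at_invmx cg (lt0r_neq0 pg)).
have csq : {for q, continuous (fun y => Num.sqrt (\det (g y)))}.
  apply: (@continuous_comp _ _ _ (fun y => \det (g y)) (@Num.sqrt R)) => //.
  exact: sqrt_continuous.
set w := Num.sqrt (\det (g q)).
have w_gt0 : 0 < w by rewrite sqrtr_gt0.
have nw0 : \forall y \near q, w / 2 < Num.sqrt (\det (g y)).
  by apply: (cvgr_gt _ csq); rewrite ltr_pdivrMr// ltr_pMr// ltr1n.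
have nw1 : \forall y \near q, Num.sqrt (\det (g y)) < w * 2.
  by apply: (cvgr_lt _ csq); rewrite ltr_pMr// ltr1n.
have nr : \forall y \near q, chart_range c y.
  exact: open_nbhs_nbhs (conj (@range_open _ _ _ c) rq).
have : \forall y \near q, [/\ chart_range c y, forall i j, `|g y i j| <= K1,
   forall i j, `|invmx (g y) i j| <= K2, w / 2 < Num.sqrt (\det (g y)) &
   Num.sqrt (\det (g y)) < w * 2].
  by near do split.
move=> /nbhs_ballP[r /= r0 rq'].
pose K := m%:R * (K1 + K2 + 1).
exists r, (K + 1), (w / 2), (w * 2); split=> //.
- by rewrite ltr_wpDl// mulr_ge0// !addr_ge0.
- by rewrite divr_gt0.
- by rewrite mulr_gt0.
have mono (A : 'M[R]_m) (K3 : R) (v : 'rV_m) B : 0 <= K3 -> K3 <= K1 + K2 + 1 ->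
    (forall i j, `|A i j| <= K3) -> (forall i, `|v 0 i| <= B) ->
    (v *m A *m v^T) 0 0 <= ((K + 1) * B) ^+ 2.
  move=> K30 K3le AK vB; rewrite (le_trans (quadratic_form_le K30 AK vB))//.
  rewrite exprMn ler_wpM2r ?sqr_ge0//.
  have S1 : 1 <= K1 + K2 + 1 by rewrite lerDr addr_ge0.
  have K0 : 0 <= K by rewrite /K mulr_ge0// (le_trans _ S1).
  rewrite (@le_trans _ _ (K ^+ 2))//; last first.
    by rewrite ler_pXn2r ?nnegrE ?addr_ge0// lerDl.
  rewrite /K exprMn ler_wpM2l ?sqr_ge0// (le_trans K3le)//.
  by rewrite expr2 ler_peMl// (le_trans _ S1).
move=> y yq; have [|ry gK1 gK2 w0 w1] := rq' y.
  by rewrite -ball_normE /= distrC.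
split=> //; last by rewrite !ltW.
- by move=> v B; apply: mono gK1 => //; lra.
- by move=> v B; apply: mono gK2 => //; lra.
Unshelve. all: by end_near. Qed.

(** * Cutoffs transported to the manifold *)

Definition cube (R : realType) (m : nat) (y0 : 'rV[R]_m) (r : R) :
  set 'rV[R]_m := [set y | `|y - y0| <= r].

Lemma cube_compact (R : realType) (m : nat) (y0 : 'rV[R]_m) (r : R) :
  0 <= r -> compact (cube y0 r).
Proof.
move=> r0.
have -> : cube y0 r =
    [set y | forall i, `[y0 0 i - r, y0 0 i + r]%classic (y ord0 i)].
  apply/seteqP; split=> y /=.
    move=> /(rV_norm_leP _ r0) h i; have := h i.
    by rewrite !mxE ler_distl in_itv.
  move=> h; apply/(rV_norm_leP _ r0) => i; have := h i.
  by rewrite !mxE ler_distl in_itv.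
apply: (@rV_compact _ _ (fun i => `[y0 0 i - r, y0 0 i + r]%classic)) => i.
exact: segment_compact.
Qed.

Section chart_cube.
Context (R : realType) (m : nat) (M : ptopologicalType)
  (X : riemannianManifold R m M) (c : chart R m M) (ac : atlas X c)
  (y0 : 'rV[R]_m) (r : R) (r0 : 0 < r)
  (cube_range : cube y0 r `<=` chart_range c).

Let Q := param c @` cube y0 r.

Lemma chart_cube_compact : compact Q.
Proof.
apply: continuous_compact; last by apply: cube_compact; exact: ltW.
apply: continuous_in_subspaceT => y; rewrite inE => /cube_range.
exact: param_continuous.
Qed.

Lemma chart_cube_closed : closed Q.
Proof.
apply: compact_closed chart_cube_compact; exact: manifold_hausdorff X.
Qed.

Lemma chart_cubeP x : Q x -> dom c x /\ cube y0 r (coord c x).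
Proof.
by move=> [y qy <-]; have [cy ey] := chart_rangeP (cube_range qy); rewrite ey.
Qed.

Definition chart_cutoff (x : M) : R :=
  if `[< dom c x >] then cutoff y0 r (coord c x) else 0.

Lemma chart_cutoff_param y : chart_range c y ->
  chart_cutoff (param c y) = cutoff y0 r y.
Proof.
by move=> /chart_rangeP[cy ey]; rewrite /chart_cutoff asboolT// ey.
Qed.

Lemma chart_cutoff_eq0 x : ~ Q x -> chart_cutoff x = 0.
Proof.
move=> nQx; rewrite /chart_cutoff; case: asboolP => // cx.
apply: cutoff_eq0 => //; rewrite ltNge; apply/negP => qx; apply: nQx.
by exists (coord c x) => //; rewrite coordK.
Qed.

Lemma chart_cutoff_support :
  closure [set x | chart_cutoff x != 0] `<=` Q.
Proof.
rewrite (proj1 (closure_id Q) chart_cube_closed).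
apply: closureS => x /= /eqP nx; apply: contrapT => /chart_cutoff_eq0.
exact: nx.
Qed.

(** Points outside the domain of the chart have a neighbourhood that misses the
    cube, because the cube is compact, hence closed, in M. *)
Lemma chart_cutoff_smooth : smooth_fun X chart_cutoff.
Proof.
move=> c' ac' k; apply: Ck_on_local => y ry.
have [c'y ey] := chart_rangeP ry.
have [cy|ncy] := pselect (dom c (param c' y)).
  exists (coord c' @` (dom c' `&` dom c)); first by rewrite chart_overlapE.
  have oN := @chart_overlap_open _ _ _ c' c.
  apply: eq_Ck_on oN _ (Ck_on_cutoff y0 r oN (atlas_compatible ac' ac k)).
  move=> z; rewrite chart_overlapE => -[_ cz] /=.
  by rewrite /chart_cutoff asboolT.
have oN : open (chart_range c' `&` param c' @^-1` (~` Q)).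
  apply: open_setI_preimage; first exact: range_open.
    by rewrite openC; exact: chart_cube_closed.
  exact: param_continuous.
exists (chart_range c' `&` param c' @^-1` (~` Q)).
  by split=> // /chart_cubeP[].
apply: eq_Ck_on oN _ (Ck_on_cst _ _ (0 : R)) => z [_ nQz] /=.
by rewrite chart_cutoff_eq0.
Qed.

Lemma chart_cutoff_test_fun U : Q `<=` U -> test_fun X U chart_cutoff.
Proof.
move=> QU; split; first exact: chart_cutoff_smooth.
  apply: subclosed_compact chart_cube_compact _; first exact: closed_closure.
  exact: chart_cutoff_support.
exact: subset_trans chart_cutoff_support QU.
Qed.

Lemma grad_sq_chart_cutoff_eq0 x : ~ Q x -> grad_sq X chart_cutoff x = 0.
Proof.
move=> nQx; set c' := chart_at X x.
have ac' := chart_at_atlas X x; have c'x := chart_at_dom X x.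
rewrite (grad_sqE ac' c'x chart_cutoff_smooth).
suff -> : chart_grad chart_cutoff c' x = 0 by rewrite !mul0mx mxE.
apply/rowP => i; rewrite !mxE.
rewrite (near_eq_derive (g := cst (0 : R))) ?derive_cst//.
have oN : open (chart_range c' `&` param c' @^-1` (~` Q)).
  apply: open_setI_preimage; first exact: range_open.
    by rewrite openC; exact: chart_cube_closed.
  exact: param_continuous.
have Nx : (chart_range c' `&` param c' @^-1` (~` Q)) (coord c' x).
  by split; [exists x|rewrite /= coordK].
apply: filterS (open_nbhs_nbhs (conj oN Nx)) => y [_ nQy].
exact: chart_cutoff_eq0.
Qed.

Lemma grad_sq_chart_cutoff_le (B K : R) x : Q x ->
  (forall (y : 'rV[R]_m) (i : 'I_m),
    `|'D_(delta_mx 0 i) (cutoff y0 r) y| <= B) ->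
  (forall (y v : 'rV[R]_m) (D : R), cube y0 r y -> (forall i, `|v 0 i| <= D) ->
    (v *m invmx (metric X c (param c y)) *m v^T) 0 0 <= (K * D) ^+ 2) ->
  grad_sq X chart_cutoff x <= (K * B) ^+ 2.
Proof.
move=> Qx dB gK; have [cx qx] := chart_cubeP Qx.
rewrite (grad_sqE ac cx chart_cutoff_smooth) -{2}(coordK cx); apply: gK => // i.
rewrite mxE (near_eq_derive (g := cutoff y0 r))//.
have rx : chart_range c (coord c x) by exists x.
have := open_nbhs_nbhs (conj (@range_open _ _ _ c) rx).
by apply: filterS => y; exact: chart_cutoff_param.
Qed.
End chart_cube.

Lemma measurable_open_borel (M : ptopologicalType) (A : set M) : open A ->
  measurable (A : set (borel M)).
Proof. by move=> oA; exact: sub_gen_smallest. Qed.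

Lemma measurable_closed_borel (M : ptopologicalType) (A : set M) : closed A ->
  measurable (A : set (borel M)).
Proof.
move=> cA; rewrite -(setCK A); apply: measurableC.
by apply: measurable_open_borel; rewrite openC.
Qed.

(** The density is squeezed between constants on the cube, and the iterated
    integral is monotone. *)
Lemma chart_cube_measure (R : realType) (m : nat) (M : ptopologicalType)
    (X : riemannianManifold R m M)
    (mu : {measure set (borel M) -> \bar R}) (hmu : riemannian_measure X mu)
    (c : chart R m M) (y0 : 'rV[R]_m) (r w0 w1 : R) :
  atlas X c -> 0 < r -> cube y0 r `<=` chart_range c ->
  0 <= w0 -> 0 <= w1 ->
  (forall y, cube y0 r y ->
    w0 <= Num.sqrt (\det (metric X c (param c y))) <= w1) ->
  (((2 * r) ^+ m * w0)%:E <= mu (param c @` cube y0 r) <=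
    ((2 * r) ^+ m * w1)%:E)%E.
Proof.
move=> ac r0 qr w00 w10 qw.
have coordQ : coord c @` (param c @` cube y0 r) = cube y0 r.
  apply/seteqP; split=> y.
    move=> [_ [z qz <-] <-].
    by have [_ ->] := chart_rangeP (qr _ qz).
  move=> qy; have [_ ey] := chart_rangeP (qr _ qy).
  by exists (param c y) => //; exists y.
rewrite (hmu c) => //; last 2 first.
- by apply: measurable_closed_borel; exact: (chart_cube_closed X r0 qr).
- by move=> x /(chart_cubeP qr)[].
rewrite coordQ -!(lebesgue_iter_cube y0 (ltW r0))//.
apply/andP; split; apply: le_lebesgue_iter => y; rewrite lee_fin.
- by rewrite mulr_ge0.
- rewrite indicE; case: (boolP (y \in _)) => [|_]; last by rewrite !mul0r.
  by rewrite inE => /qw/andP[? _]; rewrite !mul1r.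
- by rewrite mulr_ge0 ?sqrtr_ge0.
- rewrite indicE; case: (boolP (y \in _)) => [|_]; last by rewrite !mul0r.
  by rewrite inE => /qw/andP[_ ?]; rewrite !mul1r.
Qed.

(** * The Rayleigh quotient of a transported cutoff *)

Lemma integral_le_cst_set (d : measure_display) (T : measurableType d)
    (R : realType) (mu : {measure set T -> \bar R}) (U Q : set T)
    (f : T -> R) (k : R) :
  measurable U -> measurable Q -> Q `<=` U -> 0 <= k ->
  (forall x, U x -> 0 <= f x) -> (forall x, Q x -> f x <= k) ->
  (forall x, U x -> ~ Q x -> f x = 0) ->
  (\int[mu]_(x in U) (f x)%:E <= k%:E * mu Q)%E.
Proof.
move=> mU mQ QU k0 f0 fk fz.
apply: (@le_trans _ _ (\int[mu]_(x in U) (k%:E * (\1_Q x)%:E))%E).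
  apply: ge0_le_integral_nonmeasurable => x Ux; rewrite lee_fin.
    exact: f0.
  rewrite indicE; case: (boolP (x \in Q)) => [|/negP].
    by rewrite inE mulr1; exact: fk.
  by rewrite inE mulr0 => /(fz x Ux) ->.
rewrite ge0_integralZl_EFin//; last first.
  by apply/measurable_EFinP; exact: measurable_indic.
by rewrite integral_indic// setIidl.
Qed.

Lemma cst_set_le_integral (d : measure_display) (T : measurableType d)
    (R : realType) (mu : {measure set T -> \bar R}) (U Q : set T)
    (f : T -> R) (k : R) :
  measurable U -> measurable Q -> Q `<=` U -> 0 <= k ->
  (forall x, U x -> 0 <= f x) -> (forall x, Q x -> k <= f x) ->
  (k%:E * mu Q <= \int[mu]_(x in U) (f x)%:E)%E.
Proof.
move=> mU mQ QU k0 f0 fk.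
apply: (@le_trans _ _ (\int[mu]_(x in U) (k%:E * (\1_Q x)%:E))%E); last first.
  apply: ge0_le_integral_nonmeasurable => x Ux; rewrite lee_fin ?mulr_ge0//.
  rewrite indicE; case: (boolP (x \in Q)) => [|_].
    by rewrite inE mulr1; exact: fk.
  by rewrite mulr0; exact: f0.
rewrite ge0_integralZl_EFin//; last first.
  by apply/measurable_EFinP; exact: measurable_indic.
by rewrite integral_indic// setIidl.
Qed.

(** If J is infinite then its finite part is 0 and so is the quotient. *)
Lemma fine_quotient_le (R : realType) (I J : \bar R) (N D : R) :
  (0 <= I <= N%:E)%E -> (D%:E <= J)%E -> 0 < D -> fine I / fine J <= N / D.
Proof.
move: I J => [i| |] [j| |] //= /andP[] //; rewrite ?lee_fin => i0 iN DJ D0;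
  rewrite ?invr0 ?mulr0.
- have j0 : 0 < j by exact: lt_le_trans DJ.
  by apply: ler_pM => //; rewrite ?invr_ge0 ?(ltW j0)// lef_pV2 ?posrE.
- by rewrite divr_ge0 ?(ltW D0)// (le_trans i0).
Qed.

(** The numerator is bounded on the whole cube, the denominator only on the
    inner cube of ratio s, where the cutoff is at least a. *)
Lemma rayleigh_chart_cutoff_le (R : realType) (m : nat) (M : ptopologicalType)
    (X : riemannianManifold R m M)
    (mu : {measure set (borel M) -> \bar R}) (hmu : riemannian_measure X mu)
    (V : M -> R) (U : set M) (c : chart R m M) (y0 : 'rV[R]_m)
    (r s a B K w0 w1 v0 : R) :
  atlas X c -> 0 < r -> cube y0 r `<=` chart_range c ->
  measurable (U : set (borel M)) -> param c @` cube y0 r `<=` U ->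
  (forall x, U x -> 0 <= V x) ->
  0 < s <= 1 -> 0 < a -> 0 < v0 -> 0 < w0 -> 0 <= w1 ->
  (forall y, cube y0 (s * r) y ->
     a <= cutoff y0 r y /\ v0 <= V (param c y)) ->
  (forall (y : 'rV[R]_m) (i : 'I_m),
    `|'D_(delta_mx 0 i) (cutoff y0 r) y| <= B) ->
  (forall (y v : 'rV[R]_m) (D : R), cube y0 r y -> (forall i, `|v 0 i| <= D) ->
    (v *m invmx (metric X c (param c y)) *m v^T) 0 0 <= (K * D) ^+ 2) ->
  (forall y, cube y0 r y ->
    w0 <= Num.sqrt (\det (metric X c (param c y))) <= w1) ->
  rayleigh X mu V U (chart_cutoff c y0 r) <=
    ((K * B) ^+ 2 * ((2 * r) ^+ m * w1)) /
    ((v0 * a ^+ 2) * ((2 * (s * r)) ^+ m * w0)).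
Proof.
move=> ac r0 qr mU QU V0 /andP[s0 s1] a0 v00 w00 w10 sa dB gK qw.
have sr0 : 0 < s * r by rewrite mulr_gt0.
have sub : cube y0 (s * r) `<=` cube y0 r.
  by move=> y /= /le_trans; apply; rewrite ler_piMl// ltW.
have mQ : measurable (param c @` cube y0 r : set (borel M)).
  by apply: measurable_closed_borel; exact: (chart_cube_closed X r0 qr).
have mQ' : measurable (param c @` cube y0 (s * r) : set (borel M)).
  apply: measurable_closed_borel.
  exact: (chart_cube_closed X sr0 (subset_trans sub qr)).
have Q'U : param c @` cube y0 (s * r) `<=` U.
  by apply: subset_trans QU; exact: image_subset.
have /andP[_ muQ] := chart_cube_measure hmu ac r0 qr (ltW w00) w10 qw.
have /andP[muQ' _] := chart_cube_measure hmu ac sr0 (subset_trans sub qr)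
  (ltW w00) w10 (fun y qy => qw y (sub y qy)).
rewrite /rayleigh /Rintegral; apply: fine_quotient_le.
- apply/andP; split.
    by apply: integral_ge0 => x _; rewrite lee_fin grad_sq_ge0.
  apply: (@le_trans _ _ (((K * B) ^+ 2)%:E * mu (param c @` cube y0 r))%E).
    apply: integral_le_cst_set => //.
    + by rewrite sqr_ge0.
    + by move=> x _; exact: grad_sq_ge0.
    + by move=> x Qx; exact: (grad_sq_chart_cutoff_le ac r0 qr Qx).
    + by move=> x _; exact: grad_sq_chart_cutoff_eq0.
  by rewrite [leRHS]EFinM lee_wpmul2l// lee_fin sqr_ge0.
- apply: (@le_trans _ _
    ((v0 * a ^+ 2)%:E * mu (param c @` cube y0 (s * r)))%E).
    by rewrite [leLHS]EFinM lee_wpmul2l// lee_fin mulr_ge0 ?sqr_ge0// ltW.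
  apply: cst_set_le_integral => //.
  + by rewrite mulr_ge0 ?sqr_ge0// ltW.
  + by move=> x Ux; rewrite mulr_ge0 ?sqr_ge0// V0.
  + move=> _ [y qy <-]; have [ay vy] := sa y qy.
    rewrite (chart_cutoff_param _ _ (qr _ (sub _ qy))).
    rewrite ler_pM ?sqr_ge0 ?(ltW v00)//.
    by rewrite ler_pXn2r ?nnegrE ?(ltW a0)// cutoff_ge0.
- by rewrite !mulr_gt0// ?exprn_gt0// mulr_gt0.
Qed.

(** * Small cubes close to the boundary *)

(** Distance to y0 attains its minimum on the compact part of the complement of
    W that is not farther from y0 than q. *)
Lemma nearest_outside_point (R : realType) (m : nat) (W : set 'rV[R]_m)
    (y0 q : 'rV[R]_m) : open W -> W y0 -> ~ W q ->
  exists2 z, ~ W z & [/\ 0 < `|z - y0|, `|z - y0| <= `|q - y0| &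
    forall y, `|y - y0| < `|z - y0| -> W y].
Proof.
move=> oW Wy0 nWq.
pose A := cube y0 `|q - y0| `&` ~` W.
have Aq : A q by split=> //; rewrite /cube /=.
have cA : compact A.
  apply: compact_closedI; first exact: cube_compact.
  by rewrite closedC.
have cf : {within A, continuous (fun y : 'rV[R]_m => `|y - y0|)}.
  apply: continuous_subspaceT => y.
  have cB : {for y, continuous ((id : 'rV[R]_m -> 'rV[R]_m) \+ cst (- y0))}.
    by apply: continuousD; [exact: id|exact: cst_continuous].
  exact: cvg_norm cB.
have [z zA zmin] := EVT_min_rV (ex_intro _ q Aq) cA cf.
move: zA; rewrite inE => -[qz nWz]; exists z => //; split=> //.
- rewrite normr_gt0 subr_eq0; apply/eqP => zy0.
  by apply: nWz; rewrite zy0.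
- move=> y yz; apply: contrapT => nWy; move: yz; apply/negP; rewrite -leNgt.
  have [yq|] := leP `|y - y0| `|q - y0|; first by apply: zmin; rewrite inE.
  by move=> /ltW; apply: le_trans.
Qed.

Lemma boundaryE (T : topologicalType) (A : set T) (x : T) : open A ->
  boundary A x <-> closure A x /\ ~ A x.
Proof. by move=> oA; rewrite /boundary (interior_id _).1. Qed.

(** Let y0 be a point of the chart image of Omega close to that of p, z the
    nearest point outside, and rho half of the distance from y0 to z.  Points
    of the open segment from y0 to z are in Omega, so z is on the boundary, and
    it is at distance at most 3 rho from all points of the cube. *)
Lemma cube_near_boundary (R : realType) (m : nat) (M : topologicalType)
    (X : riemannianManifold R m M) (Omega : set M) (c : chart R m M) (p : M)
    (r0 K eta : R) :
  open Omega -> atlas X c -> dom c p -> boundary Omega p ->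
  0 < r0 -> 0 < K -> 0 < eta ->
  (forall y, `|y - coord c p| < r0 -> chart_range c y /\
    forall (v : 'rV_m) (B : R), (forall i, `|v 0 i| <= B) ->
      (v *m metric X c (param c y) *m v^T) 0 0 <= (K * B) ^+ 2) ->
  exists y0 rho, [/\ 0 < rho, rho < eta,
    (forall y, cube y0 rho y -> `|y - coord c p| < r0),
    param c @` cube y0 rho `<=` Omega &
    forall y, cube y0 rho y ->
      (bdist X Omega (param c y) <= (K * (3 * rho))%:E)%E].
Proof.
move=> Omega_open ac cp /(boundaryE _ Omega_open)[clp nOp] r0_gt0 K0 eta0.
move=> near_p.
set q := coord c p.
pose W := chart_range c `&` param c @^-1` Omega.
have oW : open W.
  apply: open_setI_preimage => //; [exact: range_open|exact: param_continuous].
have nWq : ~ W q by rewrite /W /= /q coordK//; case.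
(* r0 / 2 because z can be twice as far from q as y0. *)
pose e := Num.min eta (r0 / 2).
have e0 : 0 < e by rewrite lt_min eta0 divr_gt0.
have e_eta : e <= eta by rewrite ge_min lexx.
have e_r0 : e <= r0 / 2 by rewrite ge_min lexx orbT.
have [y0 Wy0 y0q] : exists2 y0, W y0 & `|q - y0| < e.
  have oB : open (dom c `&` coord c @^-1` ball q e).
    apply: open_setI_preimage; [exact: dom_open|exact: ball_open|].
    exact: Defs.coord_continuous.
  have Bp : (dom c `&` coord c @^-1` ball q e) p.
    by split=> //; exact: ballxx.
  have [x [Ox [cx qx]]] := clp _ (open_nbhs_nbhs (conj oB Bp)).
  exists (coord c x); first by split; [exists x|rewrite /= coordK].
  by move: qx; rewrite /= -ball_normE.
have [z nWz [z0 zq inW]] := nearest_outside_point oW Wy0 nWq.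
have zq' : `|z - q| < r0.
  rewrite -(subrKA y0) (le_lt_trans (ler_normD _ _))//.
  rewrite [`|y0 - q|]distrC; lra.
have rz : chart_range c z by have [] := near_p z zq'.
pose rho := `|z - y0| / 2.
have rho0 : 0 < rho by rewrite divr_gt0.
have cube_q y : cube y0 rho y -> `|y - q| < r0.
  rewrite /cube /= => yrho.
  rewrite -(subrKA y0) (le_lt_trans (ler_normD _ _))//.
  by rewrite [`|y0 - q|]distrC; rewrite /rho in yrho; lra.
exists y0, rho; split=> //.
- by rewrite /rho; lra.
- move=> _ [y yrho <-]; have [] // : W y.
  by apply: inW; rewrite (le_lt_trans yrho)// /rho; lra.
move=> y yrho.
have bz : boundary Omega (param c z).
  apply/boundaryE => //; split; last by move=> Oz; exact: nWz.
  move=> N Nz; have cz := @param_continuous _ _ _ c z rz.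
  (* A neighbourhood N of param c z contains the images of the points of the
     segment that come just before z. *)
  have cs : {for 1, continuous (param c \o segment y0 (z - y0))}.
    apply: continuous_comp; first exact: segment_continuous.
    by rewrite /segment scale1r addrC subrK.
  have N1 : nbhs (1 : R) ((param c \o segment y0 (z - y0)) @^-1` N).
    by apply: cs; rewrite /segment /= scale1r addrC subrK.
  have [d /= d0 Nd] := (nbhs_ballP _ _).1 N1.
  pose t := 1 - Num.min (d / 2) (1 / 2).
  have d2 : 0 < Num.min (d / 2) (1 / 2) by rewrite lt_min !divr_gt0.
  have dd : Num.min (d / 2) (1 / 2) <= d / 2 by rewrite ge_min lexx.
  have d1 : Num.min (d / 2) (1 / 2) <= 1 / 2 by rewrite ge_min lexx orbT.
  exists (param c (segment y0 (z - y0) t)); split.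
    have [] // : W (segment y0 (z - y0) t).
    apply: inW; rewrite /segment addrC addKr normrZ ger0_norm; last first.
      by rewrite /t; lra.
    by rewrite gtr_pMl// /t; lra.
  apply: Nd; rewrite -ball_normE /= /t opprB addrCA subrr addr0 gtr0_norm//.
  lra.
apply: (@le_trans _ _ (riem_dist X (param c y) (param c z))).
  by apply: ereal_inf_lbound; exists (param c z).
have zE : z = y + (z - y) by rewrite addrC subrK.
(* Balls of the sup norm are convex. *)
have seg_q t : 0 <= t <= 1 -> `|segment y (z - y) t - q| < r0.
  move=> /andP[t0 t1].
  have -> : segment y (z - y) t - q = (1 - t) *: (y - q) + t *: (z - q).
    by apply/rowP => i; rewrite !mxE; ring.
  rewrite (le_lt_trans (ler_normD _ _))// !normrZ !ger0_norm ?subr_ge0//.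
  have [->|tn0] := eqVneq t 0; first by rewrite subr0 mul1r mul0r addr0 cube_q.
  rewrite (@lt_le_trans _ _ ((1 - t) * r0 + t * r0))//; last first.
    by rewrite -mulrDl subrK mul1r.
  rewrite ler_ltD//; first by rewrite ler_wpM2l ?subr_ge0// ltW// cube_q.
  by rewrite ltr_pM2l// lt_def tn0.
rewrite {1}zE; apply: (riem_dist_segment_le ac).
- by move=> t t01; have [] := near_p _ (seg_q t t01).
- move=> t t01; have [_] := near_p _ (seg_q t t01); apply.
  apply/rV_norm_leP; first by rewrite mulr_ge0// ltW.
  rewrite -(subrKA y0) (le_trans (ler_normD _ _))// [`|y0 - y|]distrC.
  by move: yrho; rewrite /cube /= /rho; lra.
- by rewrite !mulr_ge0// ltW.
Qed.

(** * The first eigenvalue and its limit *)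

(** Every point of Q has a neighbourhood on which V < A for a common constant A.
    There C0 d^(- beta) <= V < A forces d > (A / C0)^(- 1 / beta), so thinner
    layers do not meet this neighbourhood and their closure misses Q. *)
Lemma compact_sub_inner_set (R : realType) (m : nat) (M : ptopologicalType)
    (X : riemannianManifold R m M) (Omega : set M) (V : M -> R)
    (C0 beta : R) (Q : set M) :
  open Omega -> {within Omega, continuous V} -> 0 < C0 -> 0 < beta ->
  (forall x, Omega x -> bdist X Omega x = (fine (bdist X Omega x))%:E /\
    0 < fine (bdist X Omega x)) ->
  (forall x, Omega x -> C0 * fine (bdist X Omega x) `^ (- beta) <= V x) ->
  compact Q -> Q !=set0 -> Q `<=` Omega ->
  exists2 delta0 : R, 0 < delta0 &
    forall delta, delta < delta0 -> Q `<=` inner_set X Omega delta.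
Proof.
move=> oO cV C00 beta0 dpos VC cQ Q0 QO.
have [x0 _ Vmax] := compact_EVT_max Q0 cQ (continuous_subspaceW QO cV).
pose A := `|V x0| + 1.
have A0 : 0 < A by rewrite ltr_wpDl.
exists ((A / C0) `^ (- beta^-1)) => [|delta ltd x Qx].
  by rewrite powR_gt0 ?divr_gt0.
split; first exact: QO.
have Ox := QO x Qx.
have VA : V x < A.
  rewrite (@le_lt_trans _ _ (V x0))//; first by apply: Vmax; rewrite inE.
  by rewrite (le_lt_trans (ler_norm _))// ltrDl.
have cVx : {for x, continuous V}.
  by move: cV; rewrite continuous_open_subspace// => /(_ x); apply; rewrite inE.
have nV : \forall y \near x, V y < A by exact: (cvgr_lt _ cVx).
have nO : nbhs x Omega by exact: open_nbhs_nbhs.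
move=> clx; have [y [[Oy yd] [_ VyA]]] := clx _ (filterI nO nV).
have [dE d0] := dpos y Oy.
move: yd; rewrite dE lte_fin; set d := fine _ in d0 * => yd.
have := le_lt_trans (VC y Oy) VyA; rewrite -/d.
rewrite powRN ltNge => /negP; apply.
rewrite ler_pdivlMr ?powR_gt0// mulrC -ler_pdivlMr//.
have le : d `^ beta <= ((A / C0) `^ (- beta^-1)) `^ beta.
  apply: ge0_ler_powR; rewrite ?nnegrE ?powR_ge0 ?(ltW beta0) ?(ltW d0)//.
  by rewrite ltW// (lt_trans yd).
rewrite (le_trans le)//.
rewrite -powRrM mulNr mulVf ?gt_eqF// powR_inv1; last first.
  by rewrite divr_ge0// ltW.
by rewrite invf_div.
Qed.

Lemma cvge0_squeeze (R : realType) (f : R -> \bar R) :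
  (forall x, (0 <= f x)%E) ->
  (forall e : R, 0 < e -> \forall x \near 0^'+, (f x <= e%:E)%E) ->
  f x @[x --> 0^'+] --> 0%E.
Proof.
move=> f0 fe A nA.
have /nbhs_ballP[e /= e0 eA] : \forall x \near (0 : R), A x%:E.
  exact/nbhs_EFin.
have e20 : 0 < e / 2 by rewrite divr_gt0.
apply: filterS (fe _ e20) => x.
rewrite -[X in _ -> X]/(A (f x)).
have := f0 x; case: (f x) => [r||] //; rewrite ?lee_fin => r0 re.
by apply: eA; rewrite -ball_normE /= sub0r normrN ger0_norm//; lra.
Qed.

Lemma lambda_ge0 (R : realType) (m : nat) (M : ptopologicalType)
    (X : riemannianManifold R m M) (mu : {measure set (borel M) -> \bar R})
    (V : M -> R) (Omega : set M) (delta : R) :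
  (forall x, Omega x -> 0 < V x) -> (0 <= lambda_ X mu V Omega delta)%E.
Proof.
move=> V0; apply: le_ereal_inf_tmp => _ [phi _ <-]; rewrite lee_fin /rayleigh.
apply: divr_ge0; apply: Rintegral_ge0 => x.
  by move=> _; exact: grad_sq_ge0.
by move=> [Ox _]; rewrite mulr_ge0 ?sqr_ge0// ltW// V0.
Qed.

(** Isolates the powers of rho: the volume factors rho^m cancel, 1 / rho^2
    comes from the gradient and rho^beta from the lower bound on V. *)
Lemma cube_quotientE (R : realType) (m : nat)
    (K B C0 s a w0 w1 beta rho : R) :
  0 < K -> 0 < C0 -> 0 < s -> 0 < a -> 0 < w0 -> 0 < rho ->
  ((K * (B / rho)) ^+ 2 * ((2 * rho) ^+ m * w1)) /
    ((C0 * (K * (3 * rho)) `^ (- beta) * a ^+ 2) *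
      ((2 * (s * rho)) ^+ m * w0)) =
  (K * B) ^+ 2 * w1 * (K * 3) `^ beta / (C0 * a ^+ 2 * s ^+ m * w0) *
    rho `^ (beta - 2).
Proof.
move=> K0 C00 s0 a0 w00 rho0.
rewrite powRB; last by rewrite (gt_eqF rho0) implybT.
rewrite (_ : rho `^ 2 = rho ^+ 2); last by rewrite powR_mulrn// ltW.
rewrite powRN [K * (3 * rho)]mulrA powRM ?mulr_ge0 ?(ltW K0) ?(ltW rho0)//.
have := powR_gt0 beta rho0; have K3 : 0 < K * 3 by rewrite mulr_gt0.
have := powR_gt0 beta K3.
move: (rho `^ beta) ((K * 3) `^ beta) => P P3 P30 P0.
rewrite !exprMn.
have := exprn_gt0 m s0; have := exprn_gt0 m rho0.
have : 0 < (2 : R) ^+ m by rewrite exprn_gt0.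
move: (s ^+ m) (rho ^+ m) ((2 : R) ^+ m) => sm rm tm tm0 rm0 sm0.
field.
by rewrite ?mulf_neq0 ?gt_eqF.
Qed.

Theorem proposition4p3 (R : realType) (m : nat) (M : ptopologicalType)
    (X : riemannianManifold R m M)
    (mu : {measure set (borel M) -> \bar R}) (hmu : riemannian_measure X mu)
    (Omega : set M) (Omega_neq0 : Omega !=set0) (Omega_open : open Omega)
    (Omega_relcompact : compact (closure Omega))
    (Omega_connected : connected Omega)
    (V : M -> R) (V_cont : {within Omega, continuous V})
    (V_gt0 : forall x, Omega x -> 0 < V x)
    (C0 C1 beta0 beta1 : R)
    (C0_gt0 : 0 < C0) (C0_lt_C1 : C0 < C1)
    (beta0_gt2 : 2 < beta0) (beta0_le_beta1 : beta0 <= beta1)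
    (V_bounds : forall x, Omega x ->
       C0 * fine (bdist X Omega x) `^ (- beta0) <= V x /\
       V x <= C1 * fine (bdist X Omega x) `^ (- beta1)) :
  cvg (lambda_ X mu V Omega delta @[delta --> 0^'+]) /\
  bar_lambda X mu V Omega = 0%E.
Proof.
have beta0_gt0 : 0 < beta0 by rewrite (lt_trans _ beta0_gt2).
(* A distance whose finite part is 0, in particular an infinite one, would make
   the upper bound on V vanish. *)
have dpos x : Omega x -> bdist X Omega x = (fine (bdist X Omega x))%:E /\
    0 < fine (bdist X Omega x).
  move=> Ox; have [_ V_le] := V_bounds x Ox.
  have dn0 : fine (bdist X Omega x) != 0.
    apply/eqP => d0; have := lt_le_trans (V_gt0 x Ox) V_le.
    rewrite d0 powR0 ?mulr0 ?ltxx// oppr_eq0 gt_eqF//.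
    exact: lt_le_trans beta0_gt0 beta0_le_beta1.
  have := bdist_ge0 X Omega x; move: dn0.
  case: (bdist X Omega x) => [d| |] //=; last by rewrite eqxx.
  by rewrite lee_fin lt_def => -> ->.
have [p bp] : boundary Omega !=set0.
  have [x Ox] := Omega_neq0; have [dE _] := dpos x Ox.
  apply/set0P/eqP => b0.
  by move: dE; rewrite /bdist b0 image_set0 ereal_inf0.
have ac := chart_at_atlas X p; have cp := chart_at_dom X p.
move: (chart_at X p) ac cp => c ac cp.
have rp : chart_range c (coord c p) by exists p.
have [r0 [K [w0 [w1 [r0_gt0 K0 w00 w10 loc]]]]] := chart_local_bounds ac rp.
have [B B0 dB] := derive_cutoff_bounded R m.
have [s [a [s01 a0 sa]]] := cutoff_lower_bound R m.
have s0 : 0 < s by case/andP: s01.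
suff small (e : R) : 0 < e ->
    \forall delta \near 0^'+, (lambda_ X mu V Omega delta <= e%:E)%E.
  have cv : lambda_ X mu V Omega delta @[delta --> 0^'+] --> 0%E.
    apply: cvge0_squeeze small => delta; exact: lambda_ge0.
  split; first by apply/cvg_ex; exists 0%E.
  exact: cvg_lim cv.
move=> e0.
(* The Rayleigh quotient of the cutoff of size rho will be at most
   A rho^(beta0 - 2). *)
pose A := (K * B) ^+ 2 * w1 * (K * 3) `^ beta0 / (C0 * a ^+ 2 * s ^+ m * w0).
have [eta eta0 Aeta] : exists2 eta, 0 < eta &
    forall rho, 0 < rho -> rho < eta -> A * rho `^ (beta0 - 2) <= e.
  have cv : A * rho `^ (beta0 - 2) @[rho --> 0^'+] --> A * 0.
    by apply: cvgMr; apply: powR_cvg0; rewrite subr_gt0.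
  rewrite mulr0 in cv.
  have [eta /= eta0 h] := cvgr_lt _ cv _ e0.
  exists eta => // rho rho0 rho_eta; apply/ltW; apply: h => //=.
  by rewrite sub0r normrN gtr0_norm.
have loc' y : `|y - coord c p| < r0 -> chart_range c y /\
    forall (v : 'rV_m) (D : R), (forall i, `|v 0 i| <= D) ->
      (v *m metric X c (param c y) *m v^T) 0 0 <= (K * D) ^+ 2.
  by move=> /loc[].
have [y0 [rho [rho0 rho_eta cube_q cubeO cube_d]]] :=
  cube_near_boundary Omega_open ac cp bp r0_gt0 K0 eta0 loc'.
have qr : cube y0 rho `<=` chart_range c by move=> y /cube_q/loc'[].
have y0_cube t : 0 <= t -> cube y0 t y0 by rewrite /cube /= subrr normr0.
have [delta0 delta0_gt0 inner] : exists2 delta0 : R, 0 < delta0 &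
    forall delta, delta < delta0 ->
      param c @` cube y0 rho `<=` inner_set X Omega delta.
  apply: (compact_sub_inner_set Omega_open V_cont C0_gt0 beta0_gt0 dpos) => //.
  - by move=> x /V_bounds[].
  - exact: (chart_cube_compact rho0 qr).
  - by exists (param c y0), y0 => //; exact/y0_cube/ltW.
have near_delta : \forall delta \near (0 : R)^'+, delta < delta0.
  exact: nbhs_right_lt.
apply: filterS near_delta => delta /inner QU.
have mU : measurable (inner_set X Omega delta : set (borel M)).
  apply: measurableD; first exact: measurable_open_borel.
  by apply: measurable_closed_borel; exact: closed_closure.
apply: (@le_trans _ _ (rayleigh X mu V (inner_set X Omega delta)
    (chart_cutoff c y0 rho))%:E).
  apply: ereal_inf_lbound; exists (chart_cutoff c y0 rho) => //; split.
    exact: chart_cutoff_test_fun.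
  exists (param c y0); rewrite chart_cutoff_param; last first.
    exact/qr/y0_cube/ltW.
  rewrite gt_eqF// (lt_le_trans a0)// sa// subrr normr0.
  by rewrite mulr_ge0// ltW.
rewrite lee_fin.
apply: (@le_trans _ _ (A * rho `^ (beta0 - 2))); last exact: Aeta.
rewrite /A -(cube_quotientE _ _ _ _ K0 C0_gt0 s0 a0 w00 rho0).
apply: rayleigh_chart_cutoff_le => //.
- by move=> x [Ox _]; rewrite ltW// V_gt0.
- by rewrite mulr_gt0// powR_gt0// !mulr_gt0.
- exact: ltW.
- move=> y ys; split; first exact: sa.
  have yrho : cube y0 rho y.
    move: ys; rewrite /cube /= => /le_trans; apply.
    by case/andP: s01 => _ s1; rewrite ler_piMl// ltW.
  have Oy : Omega (param c y) by apply: cubeO; exists y.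
  have [V_ge _] := V_bounds _ Oy; apply: le_trans V_ge.
  have [dE d0] := dpos _ Oy.
  have := cube_d _ yrho; rewrite dE lee_fin => d_le.
  rewrite ler_pM2l// !powRN lef_pV2 ?posrE ?powR_gt0 ?mulr_gt0//.
  apply: ge0_ler_powR; rewrite ?nnegrE ?(ltW beta0_gt0) ?(ltW d0)//.
  by rewrite !mulr_ge0// ltW.
- by move=> y i; exact: dB.
- by move=> y v D /cube_q/loc[_ _ h _]; exact: h.
- by move=> y /cube_q/loc[].
Qed.
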